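(* Let $N\ge1$ and let $\tau=(\tau_1,\dots,\tau_N)$ be a random $\{0,1\}$-vector distributed according to the steady state (invariant measure) of the symmetric simple exclusion process on $N$ sites with fixed boundary rates $\alpha,\beta,\gamma,\delta$. Let $A_N=[N]=\{1,\dots,N\}$ and consider the family $\{\tau_i,\,i\in A_N\}$. Let $\tilde L$ be the complete graph on $A_N$ with weight $1/N$ on each edge and let $\Psi_N$ be the function on multisets of elements of $A_N$ that is identically equal to $1$. Then $\tilde L$ is a $(\Psi_N,\mathbf{C})$ weighted dependency graph for the family $\{\tau_i,\,i\in A_N\}$, for some sequence $\mathbf{C}=(C_r)_{r\ge1}$ of positive reals that does not depend on $N$.
   Context: The symmetric simple exclusion process (SSEP) with open boundaries on $N$ sites is the continuous-time Markov chain on $\{0,1\}^N$ (entry $1$ = occupied site) with independent exponential clocks as follows: each particle attempts to jump to its right neighbour with rate $1$ and to its left neighbour with rate $1$, a jump being suppressed if the target site is occupied or does not exist; if the left-most (resp. right-most) site is empty, a particle is added there with rate $\alpha$ (resp. $\delta$); if the left-most (resp. right-most) site is occupied, its particle is removed with rate $\gamma$ (resp. $\beta$). The rates $\alpha,\beta,\gamma,\delta\ge0$ do not depend on $N$ and satisfy $\alpha+\gamma>0$ and $\beta+\delta>0$. All multisets are finite and nonempty. The joint cumulant of random variables $X_1,\dots,X_r$ with finite moments is $\kappa(X_1,\dots,X_r)=\sum_{\pi}(-1)^{\#(\pi)-1}(\#(\pi)-1)!\prod_{C\in\pi}\mathbb{E}\big(\prod_{i\in C}X_i\big)$, the sum being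 over set partitions $\pi$ of $\{1,\dots,r\}$; it is symmetric, so $\kappa(Y_\alpha;\alpha\in B)$ makes sense for a multiset $B$. A weighted graph $\tilde L$ is a finite simple graph with a weight in $[0,1]$ on each edge. For a multiset $B$ of vertices, the induced weighted graph $\tilde L[B]$ has one vertex for each element of $B$ counted with multiplicity; two vertices are joined if the corresponding vertices of $\tilde L$ are equal (then the edge has weight $1$) or joined by an edge in $\tilde L$ (then the edge has the weight of that edge). For a weighted graph $K$, $\mathcal{M}(K)$ is the maximum over spanning trees of $K$ of the product of the edge weights of the tree ($1$ if $K$ has one vertex, $0$ by convention if $K$ is disconnected). Given a sequence $\mathbf{C}$ of positive reals and a function $\Psi$ on multisets of elements of $A$, a weighted graph $\tilde L$ with vertex set $A$ is a $(\Psi,\mathbf{C})$ weighted dependency graph for a family $\{Y_\alpha,\alpha\in A\}$ of random variables if, for any $r\ge1$ and any multiset $B=\{\alpha_1,\dots,\alpha_r\}$ of elements of $A$, $|\kappa(Y_\alpha;\alpha\in B)|\le C_r\,\Psi(B)\,\mathcal{M}(\tilde L[B])$. *)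

(* Defs.v *)
From HB Require Import structures.
From mathcomp Require Import all_boot all_order all_algebra.
From mathcomp Require Import finmap multiset.
From mathcomp Require Import all_classical all_reals all_analysis.

Set Implicit Arguments.
Unset Strict Implicit.
Unset Printing Implicit Defensive.

Import Order.TTheory GRing.Theory Num.Theory.

Local Open Scope ring_scope.

(* Weighted graphs. Edges are two-element vertex sets; the value of [wt]
   outside [edges] is irrelevant. *)
Record wgraph (R : realType) (V : finType) := WGraph {
  edges : {set {set V}};
  wt : {set V} -> R;
  edges_card2 : forall e, e \in edges -> #|e| = 2%N;
  wt_01 : forall e, e \in edges -> 0 <= wt e <= 1
}.

Definition adj (V : finType) (E : {set {set V}}) : rel V :=
  [rel x y | [set x; y]%SET \in E].

Definition acyclic (V : finType) (E : {set {set V}}) : Prop :=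
  forall c : seq V, (3 <= size c)%N -> ~ ucycle (adj E) c.

Definition spanning_tree (R : realType) (V : finType) (K : wgraph R V)
    (T : {set {set V}}) : Prop :=
  [/\ T \subset edges K,
      forall x y : V, connect (adj T) x y
    & acyclic T].

(* All the products are nonnegative, so the default value 0 only matters when
   there is no spanning tree. *)
Definition max_tree_weight (R : realType) (V : finType) (K : wgraph R V) : R :=
  \big[Num.max/0]_(T : {set {set V}} | `[< spanning_tree K T >])
    \prod_(e in T) wt K e.

(* The induced weighted graph on a multiset given by an enumeration
   [B : r.-tuple A]: the vertices are the positions 0, ..., r-1.  A pair
   e = {i, j} of positions has image {B_i, B_j}, which is a singleton exactly
   when B_i = B_j. *)
Section Induced.
Variables (R : realType) (A : finType) (L : wgraph R A).
Variables (r : nat) (B : r.-tuple A).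

Definition induced_img (e : {set 'I_r}) : {set A} := (tnth B @: e)%SET.

Definition induced_edges : {set {set 'I_r}} :=
  [set e : {set 'I_r} | (#|e| == 2%N) &&
     ((#|induced_img e| == 1%N) || (induced_img e \in edges L))]%SET.

Definition induced_wt (e : {set 'I_r}) : R :=
  if #|induced_img e| == 1%N then 1 else wt L (induced_img e).

Lemma induced_card2 e : e \in induced_edges -> #|e| = 2%N.
Proof. by rewrite inE => /andP[/eqP]. Qed.

Lemma induced_wt_01 e : e \in induced_edges -> 0 <= induced_wt e <= 1.
Proof.
rewrite inE /induced_wt => /andP[_]; case: ifP => [_ _|_ /=].
  by rewrite ler01 lexx.
exact: wt_01.
Qed.

Definition induced_wgraph : wgraph R 'I_r := WGraph induced_card2 induced_wt_01.

End Induced.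

(* The moments are extracted with [fine], so this is the joint cumulant only
   when the moments involved are finite. *)
Definition joint_cumulant (d : measure_display) (T : measurableType d)
    (R : realType) (P : probability T R) (I : finType)
    (X : I -> {RV P >-> R}) : R :=
  \sum_(pi : {set {set I}} | finset.partition pi [set: I]%SET)
    (-1) ^+ #|pi|.-1 * (#|pi|.-1)`!%:R *
    \prod_(C in pi) fine 'E_P[fun w => (\prod_(i in C) X i w)%R]%E.

Arguments joint_cumulant {d T R} P {I} X.

(* Multisets of size r are ranged over through all their enumerations by
   r-tuples. *)
Definition weighted_dependency_graph (d : measure_display)
    (T : measurableType d) (R : realType) (P : probability T R) (A : finType)
    (Psi : {mset A}%mset -> R) (C : nat -> R) (L : wgraph R A)
    (Y : A -> {RV P >-> R}) : Prop :=
  forall (r : nat) (B : r.-tuple A), (1 <= r)%N ->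
    `|joint_cumulant P (fun k : 'I_r => Y (tnth B k))|
      <= C r * Psi (seq_mset B) * max_tree_weight (induced_wgraph L B).

Arguments weighted_dependency_graph {d T R} P {A} Psi C L Y.

(* The complete graph on N vertices with weight 1/N on each edge. *)
Section Complete.
Variables (R : realType) (N : nat).

Definition complete_edges : {set {set 'I_N}} :=
  [set e : {set 'I_N} | #|e| == 2%N]%SET.

Lemma complete_card2 e : e \in complete_edges -> #|e| = 2%N.
Proof. by rewrite inE => /eqP. Qed.

Lemma complete_wt_01 (e : {set 'I_N}) :
  e \in complete_edges -> 0 <= (N%:R^-1 : R) <= 1.
Proof.
move=> _; rewrite invr_ge0 ler0n /=.
by case: N => [|n]; rewrite ?invr0 ?ler01 // invf_le1 ?ltr0n // ler1n.
Qed.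

Definition complete_wgraph : wgraph R 'I_N :=
  WGraph complete_card2 complete_wt_01.

End Complete.

(* The open SSEP; sites are numbered from 0 to N-1. *)
Definition config (N : nat) := {ffun 'I_N -> bool}.

Section SSEP.
Variables (R : realType) (N : nat) (alpha beta gamma delta : R).

Definition set_site (eta : config N) (i : 'I_N) (b : bool) : config N :=
  [ffun k => if k == i then b else eta k].

Definition jump (eta : config N) (i j : 'I_N) : config N :=
  set_site (set_site eta i false) j true.

Definition neighbours (i j : 'I_N) : bool :=
  ((j : nat) == i.+1) || ((i : nat) == j.+1).

(* Total rate of the transitions from [eta] to [eta'].  Every transition
   changes the configuration, so [ssep_rate eta eta = 0].  When N = 1 the only
   site is both left-most and right-most. *)
Definition ssep_rate (eta eta' : config N) : R :=
  \sum_(i < N) \sum_(j < N | neighbours i j)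
     [&& eta i, ~~ eta j & eta' == jump eta i j]%:R
  + \sum_(i < N | (i : nat) == 0%N)
     (alpha * (~~ eta i && (eta' == set_site eta i true))%:R
      + gamma * (eta i && (eta' == set_site eta i false))%:R)
  + \sum_(i < N | i.+1 == N)
     (delta * (~~ eta i && (eta' == set_site eta i true))%:R
      + beta * (eta i && (eta' == set_site eta i false))%:R).

Definition ssep_generator (eta eta' : config N) : R :=
  ssep_rate eta eta' - (eta == eta')%:R * \sum_(xi : config N) ssep_rate eta xi.

Definition ssep_steady_state (mu : config N -> R) : Prop :=
  [/\ forall eta, 0 <= mu eta,
      \sum_(eta : config N) mu eta = 1
    & forall eta', \sum_(eta : config N) mu eta * ssep_generator eta eta' = 0].

End SSEP.

(* The family [tau], seen as a random vector, is distributed according to [mu];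
   since [mu] is a probability on {0,1}^N, this makes [tau] almost surely
   {0,1}-valued. *)
Definition distributed_as (d : measure_display) (T : measurableType d)
    (R : realType) (P : probability T R) (N : nat)
    (tau : 'I_N -> {RV P >-> R}) (mu : config N -> R) : Prop :=
  forall eta : config N,
    P [set w | forall i : 'I_N, tau i w = (eta i)%:R]%classic = (mu eta)%:E.

Arguments distributed_as {d T R} P {N} tau mu.

(* Main.v *)
From HB Require Import structures.
Require Import Defs.
From mathcomp Require Import all_boot all_order all_algebra.
From mathcomp Require Import finmap multiset.
From mathcomp Require Import all_classical all_reals all_analysis.
From mathcomp Require Import measurable_realfun measurable_fun_approximation.
From mathcomp Require Import ring lra zify.
From mathcomp Require Import perm fintype finset.

Set Implicit Arguments.
Unset Strict Implicit.
Unset Printing Implicit Defensive.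

Import Order.TTheory GRing.Theory Num.Theory.

Local Open Scope ring_scope.

(** Why the cumulants are small.  Put rho = delta / (beta + delta) and
    sigma_i = tau_i - rho.  On a product of the sigma_i over a set S of sites,
    the bulk dynamics acts by exchanging neighbouring sites, and each end of
    the system by a combination of the product and of the product without the
    factor of the end site.  The stationary moments M(S) = E[prod_(i in S) sigma_i]
    therefore solve a closed linear system ([centred_moment_equation]).  A
    Dirichlet form argument, by induction on the size of S, shows that M is
    the only solution ([moment_equation_homogeneous]), and an explicit product
    solves the system ([ssep_moment_equation]):

      M(S) = prod_(i in S) q_(r(i)) (i),   q_j(i) = c (y_i - j) / (L - j),

    where r(i) is the number of elements of S to the right of i, L is N up to
    a bounded term and y_i is, up to a bounded term, the distance from i to
    the right end.

    To bound the cumulants, shift the index: let E_j(S) be the product of the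
    q_(j + r(i)) (i) and let K_j be the cumulants of E_j.  If n is the largest
    element of S then E_j(S) = q_j(n) E_(j+1)(S - n).  Set functions form a
    commutative ring under subset convolution, in which E_j = exp K_j; the
    recursion becomes

      K_j(S) = q_j(n) * (coefficient of exp (K_(j+1) - K_j) at S - n)

    ([cumul_ranked_max], [mark_ranked_ratio]).  Since q_j(i) is a
    smooth function of j / N, every difference in j gains a factor 1 / N.  If
    K_j(C) is of order N^(1 - #C), and its differences in j are smaller by the
    corresponding powers of N, then K_(j+1) - K_j is of order N^(- #C) and the
    coefficient above is of order N^(1 - #S): this is the induction of
    [exists_cumul_bound].  At j = 0 it gives the bound for distinct sites,
    because adding a constant to the variables does not affect the cumulants
    of order at least two ([cumul_shift]).

    When a site is repeated, tau_i ^ 2 = tau_i expresses the cumulant through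
    cumulants of fewer variables whose bounds multiply to the right power of N
    ([cumul_dup], [cumul_image_bound]).  On the graph side, if k distinct
    sites occur, joining each repetition to the first occurrence of its site
    and each first occurrence to the first position gives a spanning tree of
    weight N^(1 - k) ([max_tree_weight_ge]). *)

(** * The ring of set functions *)

(** Functions on the subsets of I, to be multiplied by subset convolution: they are
    the polynomials in commuting variables x_i with x_i ^ 2 = 0.  The separate name
    keeps this product apart from the pointwise one of finite functions. *)
Definition setfun (R : comNzRingType) (I : finType) := {ffun {set I} -> R}.

Section SetFunRing.
Variables (R : comNzRingType) (I : finType).
Implicit Types (f g h : setfun R I) (S C D : {set I}).

HB.instance Definition _ := GRing.Zmodule.on (setfun R I).

Definition conv f g : setfun R I :=
  [ffun S : {set I} => \sum_(C : {set I} | C \subset S) f C * g (S :\: C)].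

Definition conv1 : setfun R I := [ffun S : {set I} => (S == set0)%:R].

Lemma setDDK S C : C \subset S -> S :\: (S :\: C) = C.
Proof. by move=> sCS; rewrite setDDr setDv set0U; apply/setIidPr. Qed.

Lemma convC : commutative conv.
Proof.
move=> f g; apply/ffunP => S; rewrite !ffunE.
rewrite (reindex_onto (fun C : {set I} => S :\: C) (fun C : {set I} => S :\: C)) /=;
  last by move=> C; exact: setDDK.
apply: eq_big => [C|C /andP[_ /eqP->]]; last by rewrite mulrC.
rewrite subsetDl /=; apply/eqP/idP => [<-|]; [exact: subsetDl | exact: setDDK].
Qed.

Lemma convA : associative conv.
Proof.
move=> f g h; apply/ffunP => S; rewrite !ffunE.
under eq_bigr => C sCS do rewrite ffunE mulr_sumr.
under [RHS]eq_bigr => C sCS do rewrite ffunE mulr_suml.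
rewrite [RHS](exchange_big_dep (fun D : {set I} => D \subset S)) /=; last first.
  by move=> C D sCS sDC; exact: subset_trans sCS.
apply: eq_bigr => D sDS.
rewrite [RHS](reindex_onto (fun C : {set I} => C :|: D) (fun C : {set I} => C :\: D)) /=;
  last first.
  by move=> C /andP[_ sDC]; rewrite setUC setDE setUIr setUCr setIT; apply/setUidPr.
apply: eq_big => [C|C].
  rewrite subUset sDS andbT subsetUr andbT subsetD setDUl setDv setU0.
  by congr (_ && _); apply/idP/eqP => /setDidPl.
rewrite subsetD => /andP[_ dCD].
by rewrite setDUl setDv setU0 (setDidPl dCD) mulrA setUC setDDl.
Qed.

Lemma conv1f : left_id conv1 conv.
Proof.
move=> f; apply/ffunP => S; rewrite ffunE (bigD1 set0) ?sub0set //= ffunE eqxx mul1r setD0.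
by rewrite big1 ?addr0 // => C /andP[_ /negPf C0]; rewrite ffunE C0 mul0r.
Qed.

Lemma convDl : left_distributive conv +%R.
Proof.
move=> f g h; apply/ffunP => S; rewrite !ffunE -big_split /=.
by apply: eq_bigr => C _; rewrite ffunE mulrDl.
Qed.

Lemma conv1_neq0 : conv1 != 0.
Proof. by apply/eqP => /ffunP/(_ set0)/eqP; rewrite !ffunE eqxx oner_eq0. Qed.

HB.instance Definition _ :=
  GRing.Zmodule_isComNzRing.Build (setfun R I) convA convC conv1f convDl conv1_neq0.

Lemma convE f g S :
  (f * g) S = \sum_(C : {set I} | C \subset S) f C * g (S :\: C).
Proof. by rewrite [LHS]ffunE. Qed.

Lemma one_setfunE S : (1 : setfun R I) S = (S == set0)%:R.
Proof. by rewrite [LHS]ffunE. Qed.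

Lemma conv_set0 f g : (f * g) set0 = f set0 * g set0.
Proof.
rewrite convE (bigD1 set0) ?sub0set //= setD0 big1 ?addr0 // => C.
by rewrite subset0 => /andP[/eqP->]; rewrite eqxx.
Qed.

Lemma conv_nilpotent f n S : f set0 = 0 -> (#|S| < n)%N -> (f ^+ n) S = 0.
Proof.
move=> f0; elim: n S => [//|n IH] S; rewrite ltnS => leSn.
rewrite exprS convE big1 // => C sCS; have [->|/set0Pn[x Cx]] := eqVneq C set0.
  by rewrite f0 mul0r.
rewrite IH ?mulr0 //; apply: leq_trans leSn; apply: proper_card.
by apply/properP; split; [exact: subsetDl | exists x; rewrite ?(subsetP sCS) // inE Cx].
Qed.

(** The geometric series stops because 1 - f is nilpotent when f set0 = 1. *)
Definition conv_inv f : setfun R I := \sum_(k < #|I|.+1) (1 - f) ^+ k.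

Lemma mulfVs f : f set0 = 1 -> f * conv_inv f = 1.
Proof.
move=> f0; have := subrXX 1 (1 - f) #|I|.+1.
rewrite expr1n subKr (eq_bigr (fun k : 'I_#|I|.+1 => (1 - f) ^+ k)) => [<-|k _];
  last by rewrite expr1n mul1r.
rewrite [X in _ - X](_ : _ = 0) ?subr0 //; apply/ffunP => S.
by rewrite conv_nilpotent ?ffunE ?ltnS ?max_card // eqxx f0 subrr.
Qed.

Lemma conv_inv0 f : f set0 = 1 -> conv_inv f set0 = 1.
Proof.
by move=> f0; have := mulfVs f0 => /ffunP/(_ set0); rewrite conv_set0 f0 mul1r one_setfunE eqxx.
Qed.

Lemma mulfIs f : f set0 = 1 -> injective (fun g => g * f).
Proof. by move=> f0 g h /(congr1 (fun u => u * conv_inv f)); rewrite -!mulrA mulfVs // !mulr1. Qed.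

(** The Euler operator x_i d/dx_i.  Unlike d/dx_i it is a derivation of the ring even
    though x_i ^ 2 = 0. *)
Definition mark (i : I) f : setfun R I := [ffun S : {set I} => (i \in S)%:R * f S].

Lemma markM i f g : mark i (f * g) = mark i f * g + f * mark i g.
Proof.
apply/ffunP => S; rewrite !ffunE mulr_sumr -big_split /=; apply: eq_bigr => C sCS.
rewrite !ffunE inE; case: (boolP (i \in C)) => [/(subsetP sCS) ->|_] /=.
  by rewrite !(mul1r, mul0r, mulr0, addr0).
by rewrite !mul0r add0r mulrCA.
Qed.

Lemma markD i f g : mark i (f + g) = mark i f + mark i g.
Proof. by apply/ffunP => S; rewrite !ffunE mulrDr. Qed.

Lemma markB i f g : mark i (f - g) = mark i f - mark i g.
Proof. by apply/ffunP => S; rewrite !ffunE mulrBr. Qed.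

Lemma mark_conv i f g S :
  (mark i f * g) S = \sum_(C : {set I} | (C \subset S) && (i \in C)) f C * g (S :\: C).
Proof.
rewrite convE big_mkcondr /=; apply: eq_bigr => C _; rewrite ffunE.
by case: (i \in C); rewrite ?mul1r ?mul0r.
Qed.

End SetFunRing.

(** * Cumulants as a logarithm *)

Section Cumulant.
Variables (R : comNzRingType) (I : finType).
Implicit Types (f g h : setfun R I) (S C D : {set I}) (pi : {set {set I}}).

Definition moebius_coef (n : nat) : R := (-1) ^+ n.-1 * (n.-1)`!%:R.

Definition cumul f : setfun R I :=
  [ffun S : {set I} => \sum_(pi : {set {set I}} | partition pi S)
     moebius_coef #|pi| * \prod_(C in pi) f C].

Lemma eq_cumul f g S :
  (forall C, C \subset S -> f C = g C) -> cumul f S = cumul g S.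
Proof.
move=> efg; rewrite !ffunE; apply: eq_bigr => pi part_pi; congr (_ * _).
by apply: eq_bigr => C piC; apply: efg; apply: partitionS piC.
Qed.

Lemma cumul_set1 f i : cumul f [set i] = f [set i].
Proof.
have part1 : partition [set [set i]] [set i].
  by rewrite /partition /cover big_set1 eqxx trivIset1 inE eq_sym -cards_eq0 cards1.
rewrite ffunE (bigD1 [set [set i]]) //= [X in _ + X]big1 ?addr0 => [|pi /andP[part_pi /eqP]].
  by rewrite cards1 /moebius_coef big_set1 !mul1r.
case; have [/set0Pn[C piC] sub] : pi != set0 /\ pi \subset [set [set i]].
  split; last first.
    apply/subsetP => C piC; have := partitionS part_pi piC.
    by rewrite subset1 (negPf (partition_neq0 part_pi piC)) orbF inE.
  apply: contraTneq part_pi => ->; rewrite /partition /cover big_set0 eq_sym.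
  by rewrite -cards_eq0 cards1.
by apply/eqP; rewrite eqEsubset sub sub1set; move: (subsetP sub _ piC) (piC); rewrite inE => /eqP->.
Qed.

Lemma block_notin_partition S D pi :
  partition pi (S :\: D) -> D != set0 -> D \notin pi.
Proof.
move=> part_pi; apply: contra => /(partitionS part_pi) sD; rewrite -subset0.
by apply/subsetP => x Dx; have := subsetP sD x Dx; rewrite inE Dx.
Qed.

(** Removing the block D is a bijection from the partitions of S with block D. *)
Lemma partition_block_sum S D (F : {set {set I}} -> R) :
  D \subset S -> D != set0 ->
  \sum_(pi : {set {set I}} | partition pi (S :\: D)) F (D |: pi)
    = \sum_(rho : {set {set I}} | partition rho S && (D \in rho)) F rho.
Proof.
move=> sDS D0.
rewrite [RHS](reindex_onto (fun pi => D |: pi) (fun rho => rho :\ D)) /=; last first.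
  by move=> rho /andP[_ Drho]; rewrite setD1K.
apply: eq_bigl => pi; rewrite setU11 andbT; apply/idP/andP => [part_pi|[part_pi /eqP epi]].
  split; last by rewrite setU1K ?(block_notin_partition part_pi D0).
  have -> : S = D :|: (S :\: D).
    by apply/setP => x; rewrite !inE; case: (boolP (x \in D)) => //= /(subsetP sDS).
  by apply: partitionU1 => //; rewrite -setI_eq0 setDE setICA setICr setI0.
rewrite -epi; exact: partitionD1 part_pi (setU11 _ _).
Qed.

Lemma card_blocks_avoiding i S pi :
  partition pi S -> i \in S -> #|[set D in pi | i \notin D]| = #|pi|.-1.
Proof.
move=> part_pi Si; have covi : i \in cover pi by rewrite (cover_partition part_pi).
have tI := partition_trivIset part_pi.
rewrite (cardsD1 (pblock pi i) pi) pblock_mem //=; apply: eq_card => D; rewrite !inE.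
case: (boolP (D \in pi)) => piD; rewrite ?andbF //= andbT; congr negb.
apply/idP/eqP => [Di|->]; first by rewrite (def_pblock tI piD Di).
by rewrite mem_pblock.
Qed.

(** The cancellation behind [cumul_rec]: a partition into n + 2 blocks arises once by
    itself, and once for each of the n + 1 blocks that can be split off. *)
Lemma moebius_coefS n : moebius_coef n.+2 + moebius_coef n.+1 *+ n.+1 = 0.
Proof.
rewrite /moebius_coef /= factS natrM exprS -mulr_natl; ring.
Qed.

(** Expanding each cumulant over the partitions of C, a term with C != S is a partition
    of S together with a distinguished block S - C avoiding i.  Summing over the choice of
    that block leaves only the partition with the single block S. *)
Lemma cumul_rec f i S : f set0 = 1 -> i \in S ->
  f S = \sum_(C : {set I} | (C \subset S) && (i \in C)) cumul f C * f (S :\: C).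
Proof.
move=> f0 Si; pose G pi := moebius_coef #|pi|.-1 * \prod_(C in pi) f C.
have -> : \sum_(C : {set I} | (C \subset S) && (i \in C)) cumul f C * f (S :\: C)
  = cumul f S + \sum_(pi | partition pi S) G pi *+ #|pi|.-1.
  rewrite (bigD1 S) ?subxx //= setDv f0 mulr1; congr (_ + _).
  rewrite (reindex_onto (fun D : {set I} => S :\: D) (fun D : {set I} => S :\: D)) /=;
    last by move=> C /andP[/andP[sCS _] _]; exact: setDDK.
  transitivity (\sum_(D : {set I} | [&& D \subset S, i \notin D & D != set0])
      \sum_(pi | partition pi S && (D \in pi)) G pi).
    have condE D : [&& S :\: D \subset S, i \in S :\: D, S :\: D != S
        & S :\: (S :\: D) == D] = [&& D \subset S, i \notin D & D != set0].
      rewrite subsetDl inE Si andbT /=.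
      have -> : (S :\: (S :\: D) == D) = (D \subset S).
        by apply/eqP/idP => [<-|]; [exact: subsetDl | exact: setDDK].
      case: (boolP (D \subset S)) => sDS; rewrite ?andbF //= andbT; congr (_ && _).
      congr negb; apply/eqP/eqP => [e|->]; last by rewrite setD0.
      by rewrite -(setDDK sDS) e setDv.
    apply: eq_big => [D|D]; rewrite -?andbA condE // => /and3P[sDS _ D0].
    rewrite -(partition_block_sum G) // setDDK // ffunE mulr_suml.
    apply: eq_bigr => pi part_pi; rewrite /G cardsU1 big_setU1 /=.
      by rewrite (block_notin_partition part_pi D0) -mulrA [f D * _]mulrC.
    exact: block_notin_partition part_pi D0.
  rewrite (exchange_big_dep (fun pi => partition pi S)) /=; last by move=> D pi _ /andP[].
  apply: eq_bigr => pi part_pi; rewrite -(card_blocks_avoiding part_pi Si) -sumr_const.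
  apply: eq_bigl => D; rewrite !inE part_pi /=; case: (boolP (D \in pi)) => piD; rewrite ?andbF //=.
  by rewrite (partitionS part_pi piD) (partition_neq0 part_pi piD) !andbT.
rewrite ffunE -big_split /= (bigD1 [set S]) /=; last first.
  rewrite /partition /cover big_set1 eqxx trivIset1 inE eq_sym /=.
  by apply/set0Pn; exists i.
rewrite cards1 big_set1 /G /= mulr0n addr0 /moebius_coef !mul1r [X in _ + X]big1 ?addr0 // => pi.
move=> /andP[part_pi piS].
have : (1 < #|pi|)%N.
  rewrite ltnNge; apply: contra piS => le1.
  have covi : i \in cover pi by rewrite (cover_partition part_pi).
  have epi : pi = [set pblock pi i].
    by apply/esym/eqP; rewrite eqEcard sub1set pblock_mem // cards1.
  by rewrite -(cover_partition part_pi) {2}epi /cover big_set1 -epi.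
case: #|pi| => [|[|n]] // _.
by rewrite -mulrnAl -mulrDl -/(moebius_coef n.+2) moebius_coefS mul0r.
Qed.

(** Logarithmic differentiation of f = exp (cumul f), in a form that needs no
    exponential. *)
Lemma mark_cumul f i : f set0 = 1 -> mark i f = mark i (cumul f) * f.
Proof.
move=> f0; apply/ffunP => S; rewrite ffunE mark_conv.
have [Si|Si] := boolP (i \in S); first by rewrite mul1r; exact: cumul_rec.
rewrite mul0r big1 // => C /andP[/subsetP sCS /sCS].
by rewrite (negPf Si).
Qed.

(** Recognizes cumulants: f is regular in the ring, so it can be cancelled from the
    logarithmic derivative. *)
Lemma cumul_unique f u : f set0 = 1 -> (forall i, mark i f = mark i u * f) ->
  forall S, S != set0 -> cumul f S = u S.
Proof.
move=> f0 uP S /set0Pn[i Si].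
have /(mulfIs f0)/ffunP/(_ S) : mark i (cumul f) * f = mark i u * f.
  by rewrite -mark_cumul.
by rewrite !ffunE Si !mul1r.
Qed.

End Cumulant.

(** * Cumulants under a shift and under repetition of variables *)

Section CumulantTransforms.
Variables (R : comNzRingType) (I : finType).
Implicit Types (f : setfun R I) (S C D : {set I}).

Definition power_setfun (a : R) : setfun R I := [ffun S : {set I} => a ^+ #|S|].

(** If f gives the mixed moments of some variables, f * power_setfun a gives those of the
    same variables plus a.  The second factor is the exponential of a set function supported
    on the singletons, so only cumulants of order one change. *)
Lemma cumul_shift f a S : f set0 = 1 -> (1 < #|S|)%N ->
  cumul (f * power_setfun a) S = cumul f S.
Proof.
move=> f0 S1; pose s : setfun R I := [ffun C : {set I} => a *+ (#|C| == 1%N)].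
have S0 : S != set0 by apply: contraTneq S1 => ->; rewrite cards0.
have markE i : mark i (power_setfun a) = mark i s * power_setfun a.
  apply/ffunP => C; rewrite mark_conv !ffunE; have [Ci|Ci] := boolP (i \in C); last first.
    rewrite mul0r big1 // => D /andP[/subsetP sDC /sDC].
    by rewrite (negPf Ci).
  rewrite (bigD1 [set i]) /= ?sub1set ?Ci ?set11 // [X in _ + X]big1 ?addr0 => [|D].
    by rewrite !ffunE cards1 mulr1n mul1r (cardsD1 i C) Ci exprS.
  move=> /andP[/andP[sDC Di] Dn]; rewrite !ffunE.
  case: cards1P => [[x ex]|_]; last by rewrite mulr0n mul0r.
  by case/eqP: Dn; move: Di; rewrite ex inE => /eqP->.
rewrite (@cumul_unique _ _ _ (cumul f + s)) //.
- by rewrite !ffunE eqn_leq [(#|S| <= 1)%N]leqNgt S1 addr0.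
- by rewrite conv_set0 f0 ffunE cards0 mulr1.
- by move=> i; rewrite markM markE mark_cumul // markD; ring.
Qed.

(** For variables with X_i X_j = X_i = X_j: differentiating f = exp (cumul f) at i and j
    expresses the moments through W below, and since the index j can be dropped from the
    moments they are expressed by V in the same way; f cancels. *)
Lemma cumul_dup f i j S :
  i != j -> f set0 = 1 ->
  (forall C, i \in C -> j \in C -> f C = f (C :\ j)) ->
  i \in S -> j \in S ->
  cumul f S = cumul f (S :\ j)
    - \sum_(C : {set I} | [&& C \subset S, i \in C & j \notin C]) cumul f C * cumul f (S :\: C).
Proof.
move=> ij f0 fdup Si Sj.
pose W := mark i (mark j (cumul f)) + mark i (cumul f) * mark j (cumul f).
pose V : setfun R I := mark i (mark j [ffun C : {set I} => cumul f (C :\ j)]).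
have WE : W * f = mark i (mark j f).
  by rewrite (mark_cumul j f0) markM (mark_cumul i f0) /W; ring.
have VE : V * f = mark i (mark j f).
  apply/ffunP => C; rewrite mark_conv !ffunE.
  have [Ci|Ci] := boolP (i \in C); last first.
    rewrite mul0r big1 // => D /andP[/subsetP sDC /sDC].
    by rewrite (negPf Ci).
  rewrite mul1r; have [Cj|Cj] := boolP (j \in C); last first.
    rewrite mul0r big1 // => D /andP[/subsetP sDC Di]; rewrite !ffunE.
    by rewrite (contraNF (sDC j) Cj) !mul0r.
  rewrite mul1r (fdup C Ci Cj) (@cumul_rec _ _ _ i) //; last by rewrite !inE ij.
  rewrite (bigID (fun D : {set I} => j \in D)) /= [X in _ + X]big1 ?addr0; last first.
    by move=> D /andP[_ /negPf Dj]; rewrite !ffunE Dj !mul0r.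
  rewrite (reindex_onto (fun D : {set I} => j |: D) (fun D : {set I} => D :\ j)) /=; last first.
    by move=> D /andP[_ Dj]; rewrite setD1K.
  apply: eq_big => [D|D /andP[_ /eqP eD]].
    rewrite setU11 andbT subUset sub1set Cj /= !inE (negPf ij) /= subsetD1.
    case: (boolP (j \in D)) => Dj /=; last by rewrite setU1K // eqxx !andbT.
    rewrite andbF; apply/negbTE/negP => /andP[_ /eqP e].
    by move: Dj; rewrite -e !inE eqxx.
  by rewrite !ffunE setU11 eD mul1r setDDl.
have -> : \sum_(C : {set I} | [&& C \subset S, i \in C & j \notin C])
    cumul f C * cumul f (S :\: C) = (mark i (cumul f) * mark j (cumul f)) S.
  rewrite mark_conv big_mkcondr [RHS]big_mkcondr /=; apply: eq_bigr => C _.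
  rewrite !ffunE !inE Sj andbT; case: (i \in C) => //=.
  by case: (j \in C); rewrite ?mul0r ?mulr0 ?mul1r.
have /(mulfIs f0)/ffunP/(_ S) : W * f = V * f by rewrite WE VE.
rewrite [W S]ffunE; move: (_ * _ : setfun R I) => g.
by rewrite !ffunE Si Sj !mul1r => <-; rewrite addrK.
Qed.

End CumulantTransforms.

(** * Sequences with small differences *)

Section Slow.
Variables (R : realFieldType) (e : R).
Hypothesis e_ge0 : 0 <= e.
Implicit Types (f g : nat -> R) (J p : nat) (K : R).

(** The i-th difference of f is at most K * e ^+ (p + i) in absolute value at every j with
    i + j <= J.  The recursive form makes the stability properties inductions on J. *)
Fixpoint slow J p K f : Prop :=
  `|f 0%N| <= K * e ^+ p /\
  (if J is J'.+1 then
     slow J' p K (fun j => f j.+1) /\ slow J' p.+1 K (fun j => f j.+1 - f j)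
   else True).

Lemma slow0E J p K f : slow J p K f -> `|f 0%N| <= K * e ^+ p.
Proof. by case: J => [|J] []. Qed.

Lemma eq_in_slow J p K f g :
  (forall j, (j <= J)%N -> f j = g j) -> slow J p K f -> slow J p K g.
Proof.
elim: J p f g => [|J IH] p f g fg /=; rewrite fg // => -[? H]; split=> //.
by case: H => H1 H2; split; [apply: IH H1 | apply: IH H2] => j jJ; rewrite ?fg // leqW.
Qed.

Lemma eq_slow J p K f g : f =1 g -> slow J p K f -> slow J p K g.
Proof. by move=> fg; apply: eq_in_slow => j _; exact: fg. Qed.

Lemma slow_leK J p K K' f : K <= K' -> slow J p K f -> slow J p K' f.
Proof.
move=> leK; elim: J p f => [|J IH] p f /= [H0 H]; split=> //.
- by apply: le_trans H0 _; rewrite ler_wpM2r ?exprn_ge0.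
- by apply: le_trans H0 _; rewrite ler_wpM2r ?exprn_ge0.
- by case: H => /IH ? /IH.
Qed.

Lemma slow_leS J p K f : slow J.+1 p K f -> slow J p K f.
Proof.
elim: J p f => [|J IH] p f [H0 [H1 H2]]; split=> //.
by split; apply: IH.
Qed.

Lemma slow_leJ J J' p K f : (J' <= J)%N -> slow J p K f -> slow J' p K f.
Proof. by move=> /subnK <-; elim: (J - J')%N => [//|n IH] /slow_leS. Qed.

Lemma slow0 J p K : 0 <= K -> slow J p K (fun=> 0).
Proof.
move=> K0; have H p' : `|0 : R| <= K * e ^+ p' by rewrite normr0 mulr_ge0 ?exprn_ge0.
elim: J p => [|J IH] p; split=> //; split; first exact: IH.
by apply: eq_slow (IH p.+1) => j; rewrite subrr.
Qed.

Lemma slow_const J K c : `|c| <= K -> slow J 0 K (fun=> c).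
Proof.
move=> cK; have K0 : 0 <= K by apply: le_trans cK.
elim: J => [|J IH]; split; rewrite ?mulr1 //; split=> //.
by apply: eq_slow (slow0 J 1 K0) => j; rewrite subrr.
Qed.

Lemma slowD J p K K' f g :
  slow J p K f -> slow J p K' g -> slow J p (K + K') (fun j => f j + g j).
Proof.
elim: J p f g => [|J IH] p f g /= [f0 Hf] [g0 Hg]; split.
- by rewrite mulrDl; apply: le_trans (ler_normD _ _) _; apply: lerD.
- by [].
- by rewrite mulrDl; apply: le_trans (ler_normD _ _) _; apply: lerD.
- case: Hf Hg => f1 f2 [g1 g2]; split; first exact: IH.
  by apply: eq_slow (IH _ _ _ f2 g2) => j; rewrite opprD addrACA.
Qed.

Lemma slow_sum (T : finType) (P : pred T) J p K (F : T -> nat -> R) : 0 <= K ->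
  (forall t, P t -> slow J p K (F t)) ->
  slow J p (K *+ #|P|) (fun j => \sum_(t | P t) F t j).
Proof.
move=> K0 HF.
apply: (@eq_slow _ _ _ (fun j => \sum_(t <- enum P) F t j)) => [j|].
  by rewrite big_enum.
have : {in enum P, forall t, P t} by move=> t; rewrite mem_enum.
rewrite cardE; elim: (enum P) => [_|t s IH Ps].
  by apply: (@eq_slow _ _ _ (fun=> 0)) (slow0 _ _ _) => // j; rewrite big_nil.
rewrite mulrS; apply: (@eq_slow _ _ _ (fun j => F t j + \sum_(t <- s) F t j)) => [j|].
  by rewrite big_cons.
apply: slowD; first by apply/HF/Ps/mem_head.
by apply: IH => u us; apply: Ps; rewrite inE us orbT.
Qed.

Lemma slow_diff J p K f : slow J.+1 p K f -> slow J p.+1 K (fun j => f j.+1 - f j).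
Proof. by case=> _ []. Qed.

(** The discrete Leibniz rule D(fg) = Df * (shift g) + f * Dg has two terms, hence the
    factor 2 at each level. *)
Lemma slowM J p p' K K' f g : 0 <= K -> 0 <= K' ->
  slow J p K f -> slow J p' K' g ->
  slow J (p + p') (2 ^+ J * (K * K')) (fun j => f j * g j).
Proof.
move=> K0 K'0; elim: J p p' f g => [|J IH] p p' f g Hf Hg.
  split=> //; rewrite normrM mul1r exprD mulrACA.
  by apply: ler_pM => //; [exact: slow0E Hf | exact: slow0E Hg].
have two_ge1 : 1 <= 2 ^+ J.+1 :> R by rewrite exprn_ege1 // ler1n.
split.
  rewrite normrM; apply: le_trans (_ : K * e ^+ p * (K' * e ^+ p') <= _).
    by apply: ler_pM => //; [exact: slow0E Hf | exact: slow0E Hg].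
  rewrite mulrACA -exprD ler_wpM2r ?exprn_ge0 // ler_peMl //; exact: mulr_ge0.
have le2 : 2 ^+ J * (K * K') <= 2 ^+ J.+1 * (K * K').
  by rewrite ler_wpM2r ?mulr_ge0 // ler_weXn2l // ler1n.
case: (Hf) => f0 [f1 f2]; case: (Hg) => g0 [g1 g2]; split.
  by apply: slow_leK le2 _; apply: IH.
have -> : 2 ^+ J.+1 * (K * K') = 2 ^+ J * (K * K') + 2 ^+ J * (K * K').
  by rewrite exprS; ring.
have A := IH _ _ _ _ f2 g1; have B := IH _ _ _ _ (slow_leS Hf) g2.
rewrite addSn in A; rewrite addnS in B.
by apply: eq_slow (slowD A B) => j; ring.
Qed.

End Slow.

(** * Products of factors depending on rank *)

Section RankedProduct.
Variables (R : comNzRingType) (I : finType) (key : I -> nat) (q : nat -> I -> R).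
Implicit Types (S C D : {set I}).

Definition rank_above S (i : I) : nat := #|[set k in S | (key i < key k)%N]|.

Definition ranked_prod (j : nat) : setfun R I :=
  [ffun S : {set I} => \prod_(i in S) q (j + rank_above S i) i].

Lemma ranked_prod0 j : ranked_prod j set0 = 1.
Proof. by rewrite ffunE big_set0. Qed.

(** The largest element has rank 0 and raises the rank of every other element by one, which
    amounts to a shift of the index j. *)
Lemma ranked_prod_max j n S : n \notin S -> (forall k, k \in S -> (key k < key n)%N) ->
  ranked_prod j (n |: S) = q j n * ranked_prod j.+1 S.
Proof.
move=> nS ltn; rewrite !ffunE big_setU1 //=; congr (_ * _).
  congr q; rewrite -[RHS]addn0; congr addn; apply/eqP; rewrite cards_eq0.
  apply/eqP/setP => k; rewrite !inE; case: eqVneq => [->|_]; first by rewrite ltnn.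
  by case: (boolP (k \in S)) => //= /ltn /ltnW; rewrite ltnNge => ->.
apply: eq_bigr => i Si; congr q; rewrite addSnnS; congr addn.
rewrite /rank_above (_ : [set k in n |: S | _] = n |: [set k in S | (key i < key k)%N]).
  by rewrite cardsU1 !inE (negPf nS).
apply/setP => k; rewrite !inE; case: eqVneq => [->|//]; by rewrite ltn.
Qed.

Definition ranked_ratio j : setfun R I := ranked_prod j.+1 * conv_inv (ranked_prod j).

Lemma ranked_ratioK j : ranked_ratio j * ranked_prod j = ranked_prod j.+1.
Proof. by rewrite /ranked_ratio -mulrA [conv_inv _ * _]mulrC mulfVs ?mulr1 ?ranked_prod0. Qed.

Lemma ranked_ratio0 j : ranked_ratio j set0 = 1.
Proof. by rewrite conv_set0 conv_inv0 ?ranked_prod0 ?mulr1. Qed.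

(** Logarithmic derivative of the quotient of two exponentials. *)
Lemma mark_ranked_ratio j i : mark i (ranked_ratio j) =
  mark i (cumul (ranked_prod j.+1) - cumul (ranked_prod j)) * ranked_ratio j.
Proof.
apply: (mulfIs (ranked_prod0 j)) => /=.
have := congr1 (mark i) (ranked_ratioK j).
rewrite markM (mark_cumul i (ranked_prod0 j)) (mark_cumul i (ranked_prod0 j.+1)).
rewrite -{2}(ranked_ratioK j) markB => /(canRL (addrK _)) ->; ring.
Qed.

Lemma ranked_ratio_rec j i S : i \in S ->
  ranked_ratio j S = \sum_(C : {set I} | (C \subset S) && (i \in C))
    (cumul (ranked_prod j.+1) C - cumul (ranked_prod j) C) * ranked_ratio j (S :\: C).
Proof.
move=> Si; have /ffunP/(_ S) := mark_ranked_ratio j i.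
rewrite mark_conv ffunE Si mul1r => ->.
by apply: eq_bigr => C _; rewrite !ffunE.
Qed.

(** By induction on the size of S: both sides satisfy the recursion of [cumul_rec] at n,
    since ranked_prod j.+1 is the product of ranked_ratio j and ranked_prod j. *)
Lemma cumul_ranked_max j n S : n \notin S -> (forall k, k \in S -> (key k < key n)%N) ->
  cumul (ranked_prod j) (n |: S) = q j n * ranked_ratio j S.
Proof.
have [m] := ubnP #|S|; elim: m S => // m IH S; rewrite ltnS => leSm nS ltn.
have H : \sum_(C : {set I} | (C \subset n |: S) && (n \in C))
      cumul (ranked_prod j) C * ranked_prod j ((n |: S) :\: C)
  = \sum_(C : {set I} | (C \subset n |: S) && (n \in C))
      (q j n * ranked_ratio j (C :\ n)) * ranked_prod j ((n |: S) :\: C).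
  rewrite -cumul_rec ?ranked_prod0 ?setU11 // ranked_prod_max // -ranked_ratioK convE mulr_sumr.
  rewrite [RHS](reindex_onto (fun D : {set I} => n |: D) (fun D : {set I} => D :\ n)) /=;
    last by move=> D /andP[_ Dj]; rewrite setD1K.
  have e1 D : (D \subset S) = [&& n |: D \subset n |: S, n \in n |: D & (n |: D) :\ n == D].
    rewrite setU11 /=; apply/idP/andP => [sDS|[sD /eqP eD]].
      by rewrite setUS // setU1K //; apply: contra nS; exact: (subsetP sDS).
    by rewrite -eD; apply/subsetP => x /[!inE]/andP[xn xD]; move/subsetP/(_ x): sD;
      rewrite !inE xD (negPf xn); exact.
  apply: eq_big => [D|D]; rewrite ?e1 -?andbA // => /and3P[_ _ /eqP eD].
  rewrite eD mulrA; congr (_ * ranked_prod j _); apply/setP => x; rewrite !inE.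
  by case: eqVneq => [->|]; rewrite ?(negPf nS) ?andbF.
move: H; rewrite (bigD1 (n |: S)) ?subxx ?setU11 //= [RHS](bigD1 (n |: S)) ?subxx ?setU11 //=.
rewrite setDv ranked_prod0 !mulr1 setU1K // (eq_bigr (fun C =>
  (q j n * ranked_ratio j (C :\ n)) * ranked_prod j ((n |: S) :\: C))); first exact: addIr.
move=> C /andP[/andP[sC Cn] CnS]; congr (_ * _).
have sCS : C :\ n \subset S.
  by apply/subsetP => x /[!inE]/andP[xn xC]; move/subsetP/(_ x): sC; rewrite !inE xC (negPf xn); exact.
rewrite -{1}(setD1K Cn) IH // ?inE ?eqxx //; last by move=> k /(subsetP sCS)/ltn.
apply: leq_trans leSm; apply: proper_card; rewrite properEneq sCS andbT.
by apply: contra CnS => /eqP <-; rewrite setD1K.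
Qed.

Lemma exists_max_key S : injective key -> S != set0 ->
  exists2 n, n \in S & forall k, k \in S :\ n -> (key k < key n)%N.
Proof.
move=> key_inj /set0Pn[i0 Si0]; case: (arg_maxnP key Si0) => n Sn nmax.
exists n => // k /[!inE]/andP[kn Sk]; rewrite ltn_neqAle (inj_eq key_inj) kn.
exact: nmax.
Qed.

End RankedProduct.

(** * Size of the cumulants of ranked products *)

Section RankedBound.
Variables (R : realFieldType) (T : nat) (K0 : R).
Hypothesis K0_ge0 : 0 <= K0.

(** The cumulant of a set of size s is of order e ^+ (s - 1), with T + 1 - m further
    differences still under control.  The constant K is uniform in e, in the index set and in
    the factors, which is what makes the final constants independent of N. *)
Definition cumul_bound m K :=
  forall e : R, 0 <= e ->
  forall (I : finType) (key : I -> nat) (q : nat -> I -> R), injective key ->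
  (forall i, slow e T 0 K0 (q^~ i)) ->
  forall S : {set I}, (0 < #|S| <= m)%N ->
  slow e (T.+1 - m) (#|S|.-1) K (fun j => cumul (ranked_prod key q j) S).

Definition ratio_bound m s K :=
  forall e : R, 0 <= e ->
  forall (I : finType) (key : I -> nat) (q : nat -> I -> R), injective key ->
  (forall i, slow e T 0 K0 (q^~ i)) ->
  forall S : {set I}, (#|S| <= s)%N ->
  slow e (T - m) #|S| K (fun j => ranked_ratio key q j S).

(** By induction on s through [ranked_ratio_rec], where the cumulants occur only in the
    differences cumul (j + 1) - cumul j: each of these gains a factor e and costs one level
    of control. *)
Lemma ratio_bound_of_cumul_bound m K : (m <= T)%N -> 0 <= K -> cumul_bound m K ->
  forall s, (s <= m)%N -> exists2 K', 0 <= K' & ratio_bound m s K'.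
Proof.
move=> mT K_ge0 HK; elim=> [_|s IH ltsm].
  exists 1 => // e e0 I key q key_inj Hq S; rewrite leqn0 => /eqP S0.
  rewrite S0; move/eqP: S0; rewrite cards_eq0 => /eqP->.
  apply: (eq_slow _ (slow_const e0 _ _)) => [j|]; first by rewrite ranked_ratio0.
  by rewrite normr1.
have [K' K'_ge0 HK'] := IH (ltnW ltsm).
pose L := 2 ^+ (T - m) * (K * K').
have L0 : 0 <= L by rewrite !mulr_ge0 ?exprn_ge0.
exists (K' + L *+ (2 ^ s.+1)) => [|e e0 I key q key_inj Hq S].
  by rewrite addr_ge0 ?mulrn_wge0.
rewrite leq_eqVlt => /orP[/eqP cardS|]; last first.
  by rewrite ltnS => leS; apply: (slow_leK e0 _ (HK' _ e0 _ _ _ key_inj Hq _ leS));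
    rewrite lerDl mulrn_wge0.
have /set0Pn[i Si] : S != set0 by rewrite -cards_eq0 cardS.
pose P := [pred C : {set I} | (C \subset S) && (i \in C)].
apply: (@slow_leK _ _ e0 _ _ (L *+ #|P|)).
  apply: (@le_trans _ _ (L *+ 2 ^ s.+1)); last by rewrite lerDr.
  apply: ler_wpMn2l => //; rewrite -cardS -card_powerset.
  by apply: subset_leq_card; apply/subsetP => C; rewrite !inE => /andP[].
apply: eq_slow (slow_sum e0 _ _) => [j||C /andP[sCS Ci]].
- by rewrite (ranked_ratio_rec _ _ _ Si).
- by [].
have C_gt0 : (0 < #|C|)%N by apply/card_gt0P; exists i.
have leCS := subset_leq_card sCS.
have cardD : (#|S :\: C| + #|C| = #|S|)%N by rewrite cardsD (setIidPr sCS) subnK.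
have -> : #|S| = ((#|C|.-1).+1 + #|S :\: C|)%N by rewrite prednK // addnC.
apply: slowM => //; last by apply: HK' => //; lia.
apply: slow_diff => //; rewrite -subSn //; apply: HK => //; lia.
Qed.

(** The cumulant at n |: S is one factor, of order 0, times the ratio at S, of order #|S|. *)
Lemma exists_cumul_bound m : (m <= T.+1)%N -> exists2 K, 0 <= K & cumul_bound m K.
Proof.
elim: m => [_|m IH ltmT].
  exists 0 => // e e0 I key q key_inj Hq S /andP[S0]; rewrite leqNgt S0.
  by [].
have [K K_ge0 HK] := IH (ltnW ltmT).
have [K' K'_ge0 HK'] := ratio_bound_of_cumul_bound ltmT K_ge0 HK (leqnn m).
exists (2 ^+ (T - m) * (K0 * K')) => [|e e0 I key q key_inj Hq S /andP[S_gt0 leSm]].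
  by rewrite !mulr_ge0 ?exprn_ge0.
have S0 : S != set0 by rewrite -card_gt0.
have [n Sn nmax] := exists_max_key key_inj S0.
apply: (@eq_slow _ _ _ _ _ (fun j => q j n * ranked_ratio key q j (S :\ n))) => [j|].
  by rewrite -cumul_ranked_max ?setD1K // !inE eqxx.
rewrite subSS (_ : #|S|.-1 = 0 + #|S :\ n|)%N; last by rewrite (cardsD1 n S) Sn.
have leSn : (#|S :\ n| <= m)%N by move: leSm; rewrite (cardsD1 n S) Sn.
apply: slowM => //; last exact: HK'.
by apply: (slow_leJ (leq_subr m T)).
Qed.

End RankedBound.

(** * The linear system satisfied by the centred moments *)

Section MomentEquations.
Variables (R : realFieldType) (N : nat) (A B c : R).
Implicit Types (M D : {set 'I_N} -> R) (S : {set 'I_N}) (i j : 'I_N).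

Definition swap i j S : {set 'I_N} := tperm i j @: S.

Lemma swapK i j : involutive (swap i j).
Proof.
move=> S; rewrite /swap -imset_comp (eq_imset _ (g := id)) ?imset_id // => k /=.
exact: tpermK.
Qed.

Lemma card_swap i j S : #|swap i j S| = #|S|.
Proof. exact: card_imset perm_inj. Qed.

Lemma swapC i j S : swap i j S = swap j i S.
Proof. by rewrite /swap tpermC. Qed.

Lemma swap_in_out i j S : i \in S -> j \notin S -> swap i j S = j |: S :\ i.
Proof.
move=> Si Sj; apply/eqP; rewrite eq_sym eqEcard card_swap cardsU1 !inE (negPf Sj) andbF.
rewrite (cardsD1 i S) Si leqnn andbT subUset sub1set.
apply/andP; split; first by apply/imsetP; exists i; rewrite ?tpermL.
apply/subsetP => k /[!inE]/andP[ki Sk]; apply/imsetP; exists k => //.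
by rewrite tpermD // eq_sym // ; apply: contraTneq Sk => ->.
Qed.

Lemma swap_id i j S : (i \in S) = (j \in S) -> swap i j S = S.
Proof.
move=> eij; apply/eqP; rewrite eqEcard card_swap leqnn andbT.
apply/subsetP => _ /imsetP[k Sk ->].
by case: tpermP Sk => [->|->|//]; rewrite eij.
Qed.

Lemma neighboursC i j : neighbours i j = neighbours j i.
Proof. by rewrite /neighbours orbC. Qed.

Lemma sum_neighboursC (F : 'I_N -> 'I_N -> R) :
  \sum_i \sum_(j | neighbours i j) F i j = \sum_i \sum_(j | neighbours i j) F j i.
Proof.
rewrite (exchange_big_dep predT) //=; apply: eq_bigr => i _.
by apply: eq_bigl => j; rewrite neighboursC.
Qed.

(** A and B are the total rates of the left and of the right reservoir, and c is the
    difference of their densities.  Each bond is counted in both directions, hence the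
    factor 2. *)
Definition moment_equation M S : Prop :=
  \sum_i \sum_(j | neighbours i j) (M (swap i j S) - M S) =
    2 * (\sum_(i < N | (i == 0 :> nat) && (i \in S)) A * (M S - c * M (S :\ i))
         + \sum_(i < N | (i.+1 == N) && (i \in S)) B * M S).

Lemma moment_equationB M M' S : moment_equation M S -> moment_equation M' S ->
  moment_equation (fun S => M S - M' S) S.
Proof.
rewrite /moment_equation => E E'.
transitivity (\sum_i \sum_(j | neighbours i j) (M (swap i j S) - M S)
   - \sum_i \sum_(j | neighbours i j) (M' (swap i j S) - M' S)).
  rewrite -sumrB; apply: eq_bigr => i _; rewrite -sumrB; apply: eq_bigr => j _; ring.
rewrite E E' -mulrBr opprD addrACA -!sumrB; congr (_ * (_ + _)); apply: eq_bigr => i _; ring.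
Qed.

(** Summation by parts: swap i j is an involution preserving cardinals. *)
Lemma dirichlet_form D n i j :
  2 * \sum_(S : {set 'I_N} | #|S| == n) D S * (D (swap i j S) - D S)
    = - \sum_(S : {set 'I_N} | #|S| == n) (D (swap i j S) - D S) ^+ 2.
Proof.
rewrite mulr2n mulrDl mul1r [X in X + _](reindex_inj (can_inj (swapK i j))) /=.
under eq_bigl do rewrite card_swap.
rewrite -big_split -sumrN /=; apply: eq_bigr => S _; rewrite swapK; ring.
Qed.

Hypotheses (A_gt0 : 0 < A) (B_gt0 : 0 < B).

(** By induction on the size n of S.  The terms D (S - i) vanish by induction; summing the
    equations against D over the sets of size n writes 0 as a sum of nonnegative terms, so D
    is invariant under exchanges of neighbours and vanishes on the sets containing the last
    site.  Any nonempty set can be moved by such exchanges until it contains the last site. *)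
Lemma moment_equation_homogeneous D :
  D set0 = 0 -> (forall S, moment_equation D S) -> forall S, D S = 0.
Proof.
move=> D0 E S; have [n] := ubnP #|S|; elim: n S => // n IH S; rewrite ltnS => leSn.
have [cardS|cardS] := eqVneq #|S| n; last by apply: IH; rewrite ltn_neqAle cardS.
have [n0|n0] := eqVneq n 0%N.
  by move: cardS; rewrite n0 => /eqP; rewrite cards_eq0 => /eqP->.
have DD i (T : {set 'I_N}) : #|T| == n -> i \in T -> D (T :\ i) = 0.
  by move=> /eqP cardT Ti; apply: IH; rewrite -cardT (cardsD1 i T) Ti.
pose X := \sum_(T : {set 'I_N} | #|T| == n) \sum_i \sum_(j | neighbours i j)
   (D (swap i j T) - D T) ^+ 2.
pose Y := \sum_(T : {set 'I_N} | #|T| == n)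
  (\sum_(i < N | (i == 0 :> nat) && (i \in T)) A * D T ^+ 2
   + \sum_(i < N | (i.+1 == N) && (i \in T)) B * D T ^+ 2).
have Yterm_ge0 (T : {set 'I_N}) : 0 <= \sum_(i < N | (i == 0 :> nat) && (i \in T)) A * D T ^+ 2
   + \sum_(i < N | (i.+1 == N) && (i \in T)) B * D T ^+ 2.
  by apply: addr_ge0; apply: sumr_ge0 => i _; rewrite mulr_ge0 ?sqr_ge0 ?ltW.
have Xterm_ge0 (T : {set 'I_N}) : 0 <= \sum_i \sum_(j | neighbours i j) (D (swap i j T) - D T) ^+ 2.
  by apply: sumr_ge0 => i _; apply: sumr_ge0 => j _; exact: sqr_ge0.
(* X is a multiple of the Dirichlet form of D, Y collects the loss at the two ends. *)
have XY : X + 4 * Y = 0.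
  have : 2 * \sum_(T : {set 'I_N} | #|T| == n)
      D T * (\sum_i \sum_(j | neighbours i j) (D (swap i j T) - D T)) = - X.
    under eq_bigr => T _.
      rewrite mulr_sumr; under eq_bigr => i _ do rewrite mulr_sumr; over.
    rewrite exchange_big /= mulr_sumr /X [in RHS]exchange_big /= -sumrN; apply: eq_bigr => i _.
    rewrite exchange_big /= mulr_sumr [in RHS]exchange_big /= -sumrN; apply: eq_bigr => j _.
    exact: dirichlet_form.
  move/esym/(canRL (@opprK _)) => ->; rewrite /Y; apply/eqP; rewrite addrC subr_eq0 !mulr_sumr.
  apply/eqP; apply: eq_bigr => T cardT; rewrite E.
  rewrite [in RHS](eq_bigr (fun=> A * D T)) => [|i /andP[_ Ti]]; last first.
    by rewrite DD // mulr0 subr0.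
  rewrite (_ : 4 = 2 * 2 :> R) -?mulrA ?[D T * (2 * _)]mulrCA; last by ring.
  congr (_ * (_ * _)); rewrite mulrDr !mulr_sumr; congr (_ + _); apply: eq_bigr => i _; ring.
have X_ge0 : 0 <= X by apply: sumr_ge0.
have Y_ge0 : 0 <= Y by apply: sumr_ge0.
have X0 : X = 0 by lra.
have Y0 : Y = 0 by lra.
have Dswap (T : {set 'I_N}) i j : #|T| == n -> neighbours i j -> D (swap i j T) = D T.
  move=> cardT nij.
  have XT := psumr_eq0P (fun T _ => Xterm_ge0 T) X0 cardT.
  have Xi : \sum_(j | neighbours i j) (D (swap i j T) - D T) ^+ 2 = 0.
    by apply: (psumr_eq0P _ XT) => // k _; apply: sumr_ge0 => l _; exact: sqr_ge0.
  have /eqP := psumr_eq0P (fun j _ => sqr_ge0 _) Xi nij.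
  by rewrite sqrf_eq0 subr_eq0 => /eqP.
have Dlast (T : {set 'I_N}) i : #|T| == n -> i.+1 = N -> i \in T -> D T = 0.
  move=> cardT iN Ti; have := psumr_eq0P (fun T _ => Yterm_ge0 T) Y0 cardT.
  have s1 : 0 <= \sum_(k < N | (k == 0 :> nat) && (k \in T)) A * D T ^+ 2.
    by apply: sumr_ge0 => k _; rewrite mulr_ge0 ?sqr_ge0 ?ltW.
  have t2 : 0 <= B * D T ^+ 2 by rewrite mulr_ge0 ?sqr_ge0 ?ltW.
  have s2 : 0 <= \sum_(k < N | (k.+1 == N) && (k \in T)) B * D T ^+ 2 by apply: sumr_ge0.
  move=> s12; have s20 : \sum_(k < N | (k.+1 == N) && (k \in T)) B * D T ^+ 2 = 0 by lra.
  have iP : (i.+1 == N) && (i \in T) by rewrite iN eqxx.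
  have /eqP := psumr_eq0P (fun k _ => t2) s20 iP.
  by rewrite mulf_eq0 gt_eqF //= sqrf_eq0 => /eqP.
have /set0Pn[i Si] : S != set0 by rewrite -card_gt0 cardS lt0n.
(* Push an element of S to the right until it reaches the last site. *)
have [k] := ubnP (N - i); elim: k i S Si cardS {leSn} => // k IHk i S Si cardS; rewrite ltnS => lek.
have [iN|iN] := eqVneq i.+1 N; first by apply: Dlast iN Si; rewrite cardS.
have ltiN : (i.+1 < N)%N by rewrite ltn_neqAle iN ltn_ord.
pose j := Ordinal ltiN; have nij : neighbours i j by rewrite /neighbours eqxx.
rewrite -(Dswap S i j) ?cardS //; apply: (IHk j); rewrite ?card_swap //=.
  by apply/imsetP; exists i; rewrite ?tpermL.
by apply: leq_trans lek; rewrite ltn_sub2l.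
Qed.

End MomentEquations.

(** * The product formula *)

Section RankedConst.
Variables (R : comNzRingType) (I : finType) (key : I -> nat).
Hypothesis key_inj : injective key.

Lemma ranked_prod_const (F : nat -> R) j (S : {set I}) :
  ranked_prod key (fun k _ => F k) j S = \prod_(k < #|S|) F (j + k)%N.
Proof.
have [n] := ubnP #|S|; elim: n j S => // n IH j S; rewrite ltnS => leSn.
have [->|S0] := eqVneq S set0; first by rewrite ranked_prod0 cards0 big_ord0.
have [i Si imax] := exists_max_key key_inj S0.
have cardS : #|S| = #|S :\ i|.+1 by rewrite (cardsD1 i S) Si.
rewrite cardS big_ord_recl /= addn0 -{1}(setD1K Si) ranked_prod_max ?inE ?eqxx //.
rewrite IH -?cardS //; congr (_ * _); apply: eq_bigr => k _.
by rewrite /= addSnnS.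
Qed.

End RankedConst.

Section ProductFormula.
Variables (R : realFieldType) (N : nat) (a b c : R).
Hypotheses (a_gt0 : 0 < a) (b_gt0 : 0 < b).
Implicit Types (S : {set 'I_N}) (i j k : 'I_N).

(** The distance from i to a reservoir placed at N - 1 + b; the other reservoir is at - a, and
    ssep_length is the distance between them.  Here a and b are the inverses of the total
    exchange rates at the two ends. *)
Definition site_height i : R := N%:R - 1 - i%:R + b.
Definition ssep_length : R := N%:R - 1 + a + b.
Definition ssep_factor (k : nat) i : R := c * (site_height i - k%:R) / (ssep_length - k%:R).

Local Notation y := site_height.
Local Notation L := ssep_length.
Local Notation rk := (rank_above (@nat_of_ord N)).

Definition ssep_moment S : R := ranked_prod (@nat_of_ord N) ssep_factor 0 S.

Definition height_prod S : R := \prod_(i in S) (y i - (rk S i)%:R).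
Definition height_prod_but S i : R := \prod_(k in S :\ i) (y k - (rk S k)%:R).
Local Notation P := height_prod_but.

(** The denominators depend on S through its size only, which the dynamics in the bulk preserves. *)
Definition length_prod (n : nat) : R := \prod_(k < n) (c / (L - k%:R)).

Lemma ssep_momentE S : ssep_moment S = length_prod #|S| * height_prod S.
Proof.
have -> : length_prod #|S| = ranked_prod (@nat_of_ord N) (fun (k : nat) _ => c / (L - k%:R)) 0 S.
  by rewrite (ranked_prod_const (@ord_inj N)).
rewrite /ssep_moment !ffunE -big_split /=.
by apply: eq_bigr => i _; rewrite add0n /ssep_factor; ring.
Qed.

Lemma height_prodD1 S i : i \in S -> height_prod S = (y i - (rk S i)%:R) * P S i.
Proof. by move=> Si; rewrite /height_prod (big_setD1 i). Qed.

(** A particle that moves to an empty neighbouring site keeps its rank and does not change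
    the rank of the others: only one factor changes. *)
Lemma height_prod_swap S i j : i \in S -> j \notin S -> neighbours i j ->
  height_prod (swap i j S) - height_prod S = (i%:R - j%:R) * P S i.
Proof.
move=> Si Sj nij; have jD : j \notin S :\ i by rewrite !inE (negPf Sj) andbF.
have rk_swap k : (k \in S :\ i) || (k == j) ->
    rk (swap i j S) k = rk S (if k == j then i else k).
  move=> kS; rewrite /rank_above swap_in_out //; case: (eqVneq k j) kS => [->|kj].
    move=> _; apply: eq_card => l; rewrite !inE.
    case: (eqVneq l j) => [->|lj] /=; first by rewrite ltnn (negPf Sj).
    case: (eqVneq l i) => [->|li] /=; first by rewrite ltnn andbF.
    case: (l \in S) => //=; move: nij lj li; rewrite /neighbours -!val_eqE /=; lia.
  rewrite orbF !inE => /andP[ki Sk].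
  have [ltik|leki] := ltnP k i.
    have ltjk : (k < j)%N by move: nij kj ki; rewrite /neighbours -!val_eqE /=; lia.
    rewrite (cardsD1 j) [RHS](cardsD1 i) !inE eqxx Si ltik ltjk /=; congr addn.
    apply: eq_card => l; rewrite !inE.
    case: (eqVneq l j) => [->|lj] /=; first by rewrite (negPf Sj) andbF.
    by rewrite andbA.
  have ltjk : (k < j)%N = false by move: nij kj ki leki; rewrite /neighbours -!val_eqE /=; lia.
  apply: eq_card => l; rewrite !inE.
  case: (eqVneq l j) => [->|lj] /=; first by rewrite ltjk (negPf Sj).
  case: (eqVneq l i) => [->|li] //=; by rewrite ltnNge leki andbF.
rewrite (height_prodD1 Si) /height_prod {1}swap_in_out // big_setU1 //=.
rewrite rk_swap ?eqxx ?orbT // (_ : \prod_(k in S :\ i) _ = P S i); last first.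
  apply: eq_bigr => k kS; rewrite rk_swap ?kS //.
  by case: eqVneq kS jD => [->|//] ->.
rewrite -mulrBl; congr (_ * _); rewrite /y; ring.
Qed.

(** The factors of two adjacent particles are equal: from left to right the height decreases
    by one, and so does the rank.  This is what makes the exclusion rule compatible with the
    product. *)
Lemma height_prod_but_neighbours S i j : i \in S -> j \in S -> neighbours i j -> P S i = P S j.
Proof.
wlog ltij : i j / (i < j)%N => [H|] Si Sj nij.
  have [/H->|ltji|/ord_inj->] // := ltngtP i j.
  by rewrite (H j i) // neighboursC.
have eji : j = i.+1 :> nat by move: nij; rewrite /neighbours; lia.
have ij : i != j by rewrite -val_eqE /= neq_ltn ltij.
rewrite /P (big_setD1 j) ?inE ?(eq_sym j) ?ij //= [RHS](big_setD1 i) ?inE ?ij //=.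
congr (_ * _); last by apply: eq_bigl => k; rewrite !inE andbCA.
have -> : rk S i = (rk S j).+1.
  rewrite /rank_above (cardsD1 j) !inE Sj ltij /= add1n; congr _.+1.
  apply: eq_card => k; rewrite !inE; case: (k \in S); rewrite ?andbF //=.
  by rewrite -val_eqE /=; lia.
rewrite /y eji -!natr1; ring.
Qed.

Lemma sum_neighbours i :
  \sum_(j | neighbours i j) (i%:R - j%:R) = (i.+1 == N)%:R - (i == 0 :> nat)%:R :> R.
Proof.
have E (j : 'I_N) : (if neighbours i j then i%:R - j%:R else 0 : R)
    = (i == j.+1 :> nat)%:R - (j == i.+1 :> nat)%:R.
  rewrite /neighbours; have [->|ji] := eqVneq (j : nat) i.+1.
    by rewrite /= -natr1 (_ : (_ == _) = false) ?mulr0n ?mulr1n; [ring | lia].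
  have [->|ij] /= := eqVneq (i : nat) j.+1; last by rewrite subrr.
  by rewrite -natr1; ring.
rewrite big_mkcond /= (eq_bigr _ (fun j _ => E j)) sumrB.
have -> : \sum_(j < N) (j == i.+1 :> nat)%:R = 1 - (i.+1 == N)%:R :> R.
  have [iN|iN] := eqVneq i.+1 N.
    rewrite subrr big1 // => j _; rewrite iN.
    by rewrite (_ : (_ == _) = false) //; apply/negbTE; rewrite neq_ltn ltn_ord.
  have ltiN : (i.+1 < N)%N by rewrite ltn_neqAle iN ltn_ord.
  rewrite (bigD1 (Ordinal ltiN)) //= eqxx big1 ?addr0 ?subr0 // => j.
  by rewrite -val_eqE /= => /negPf ->.
have -> : \sum_(j < N) (i == j.+1 :> nat)%:R = 1 - (i == 0 :> nat)%:R :> R.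
  have [i0|i0] := eqVneq (i : nat) 0%N; first by rewrite subrr big1 // => j _; rewrite i0.
  have lti : (i.-1 < N)%N by apply: leq_ltn_trans (ltn_ord i); exact: leq_pred.
  rewrite (bigD1 (Ordinal lti)) //= prednK ?lt0n // eqxx big1 ?addr0 ?subr0 // => j.
  by rewrite -val_eqE /= => ji; rewrite (_ : (_ == _) = false) //; lia.
ring.
Qed.

(** The sum can be extended to the bonds between two particles of S, whose contributions
    cancel in pairs by [height_prod_but_neighbours].  Then every particle sees all its
    neighbours, and only the ends of the system contribute. *)
Lemma sum_height_prod_swap S :
  \sum_i \sum_(j | neighbours i j) (height_prod (swap i j S) - height_prod S)
    = 2 * \sum_(i in S) ((i.+1 == N)%:R - (i == 0 :> nat)%:R) * P S i.
Proof.
pose F i j := (i%:R - j%:R) * P S i.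
pose G i j := if (i \in S) && (j \notin S) then F i j else 0.
have E i j : neighbours i j -> height_prod (swap i j S) - height_prod S = G i j + G j i.
  move=> nij; rewrite /G; case: (boolP (i \in S)) (boolP (j \in S)) => Si [] Sj /=.
  - by rewrite swap_id ?Si ?Sj // subrr addr0.
  - by rewrite addr0 height_prod_swap.
  - by rewrite add0r swapC height_prod_swap // neighboursC.
  - by rewrite swap_id ?(negPf Si) ?(negPf Sj) // subrr addr0.
transitivity (2 * \sum_i \sum_(j | neighbours i j) G i j).
  rewrite mulr2n mulrDl mul1r [X in _ = _ + X]sum_neighboursC -big_split /=; apply: eq_bigr => i _.
  by rewrite -big_split /=; apply: eq_bigr => j; exact: E.
congr (_ * _); pose H i j := if (i \in S) && (j \in S) then F i j else 0.
have H0 : \sum_i \sum_(j | neighbours i j) H i j = 0.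
  have : \sum_i \sum_(j | neighbours i j) H i j = - \sum_i \sum_(j | neighbours i j) H i j.
    rewrite {1}sum_neighboursC -sumrN; apply: eq_bigr => i _; rewrite -sumrN; apply: eq_bigr => j nij.
    rewrite /H andbC; case: ifP => [/andP[Si Sj]|_]; last by rewrite oppr0.
    by rewrite /F (height_prod_but_neighbours Si Sj nij); ring.
  by move=> ?; lra.
transitivity (\sum_i \sum_(j | neighbours i j) G i j + \sum_i \sum_(j | neighbours i j) H i j).
  by rewrite H0 addr0.
rewrite -big_split [RHS]big_mkcond /=; apply: eq_bigr => i _.
rewrite -big_split /= /G /H; case: (boolP (i \in S)) => Si /=; last first.
  by rewrite big1 // => j _; rewrite addr0.
rewrite -sum_neighbours mulr_suml; apply: eq_bigr => j _.
by case: (j \in S); rewrite ?addr0 ?add0r.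
Qed.

Lemma ssep_length_gt (k : nat) : (k < N)%N -> 0 < L - k%:R.
Proof.
move=> kN; have : k.+1%:R <= N%:R :> R by rewrite ler_nat.
rewrite -natr1 /L; move: (N%:R : R) (k%:R : R) => n m H; move: a_gt0 b_gt0 => a0 b0; clear kN; lra.
Qed.

Lemma ssep_moment_equation S : moment_equation a^-1 b^-1 c ssep_moment S.
Proof.
rewrite /moment_equation.
transitivity (length_prod #|S| *
  \sum_i \sum_(j | neighbours i j) (height_prod (swap i j S) - height_prod S)).
  rewrite mulr_sumr; apply: eq_bigr => i _; rewrite mulr_sumr; apply: eq_bigr => j _.
  by rewrite !ssep_momentE card_swap mulrBr.
rewrite sum_height_prod_swap mulrCA; congr (_ * _).
rewrite mulr_sumr (eq_bigr (fun i : 'I_N => - ((i == 0 :> nat)%:R * (length_prod #|S| * P S i))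
   + (i.+1 == N)%:R * (length_prod #|S| * P S i))); last by move=> i _; ring.
rewrite big_split /=; congr (_ + _); rewrite [RHS]big_mkcondl /= [RHS]big_mkcond [LHS]big_mkcond /=.
  apply: eq_bigr => i _; case: ifP => // Si; case: eqP => i0; last by rewrite mul0r oppr0.
  rewrite mul1r !ssep_momentE (height_prodD1 Si) (cardsD1 i S) Si add1n.
  have -> : height_prod (S :\ i) = P S i.
    apply: eq_bigr => k /[!inE]/andP[ki Sk]; congr (_ - _%:R); apply: eq_card => l.
    by rewrite !inE; case: (eqVneq l i) => [->|//] /=; rewrite i0 ltn0 andbF.
  have rki : rk S i = #|S :\ i|.
    apply: eq_card => l; rewrite !inE andbC; congr andb.
    by rewrite i0 lt0n -val_eqE /= i0.
  have leN : (#|S :\ i| < N)%N.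
    by rewrite -[X in (_ < X)%N]card_ord; apply: (leq_trans _ (max_card (mem S)));
       rewrite [X in (_ < X)%N](cardsD1 i) Si.
  (* At the left end the site has rank #|S| - 1, and y i - L = - a there. *)
  rewrite rki /length_prod big_ord_recr /= /y i0.
  have := lt0r_neq0 (ssep_length_gt leN); rewrite /L => Ln0.
  have an0 := lt0r_neq0 a_gt0.
  move: (\prod_(_ < _) _) => d; field.
  by rewrite an0 Ln0.
apply: eq_bigr => i _; case: ifP => // Si; case: eqP => iN; last by rewrite mul0r.
rewrite mul1r ssep_momentE (height_prodD1 Si).
have -> : rk S i = 0%N.
  apply/eqP; rewrite cards_eq0; apply/eqP/setP => l; rewrite !inE.
  by apply/negbTE; rewrite negb_and -leqNgt -ltnS iN ltn_ord orbT.
rewrite /y -[in N%:R]iN -natr1 (_ : _ - 0%:R = b); last by rewrite mulr0n; ring.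
by field; exact: lt0r_neq0.
Qed.

End ProductFormula.

(** * Stationarity of the moments *)

Section SteadyState.
Variables (R : realType) (N : nat) (alpha beta gamma delta : R).
Variable mu : config N -> R.
Implicit Types (eta : config N) (g : config N -> R) (S : {set 'I_N}) (i j : 'I_N).

Local Notation rate := (ssep_rate alpha beta gamma delta).

(** Stationarity tested on g; the diagonal of the generator contributes the term g eta. *)
Lemma steady_state_generator g : ssep_steady_state alpha beta gamma delta mu ->
  \sum_eta mu eta * (\sum_eta' rate eta eta' * (g eta' - g eta)) = 0.
Proof.
case=> _ _ st; transitivity (\sum_eta' (\sum_eta mu eta *
   ssep_generator alpha beta gamma delta eta eta') * g eta'); last first.
  by rewrite big1 // => eta' _; rewrite st mul0r.
under [RHS]eq_bigr => eta' _ do rewrite mulr_suml.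
rewrite [RHS]exchange_big /=; apply: eq_bigr => eta _.
under [RHS]eq_bigr => eta' _ do rewrite -mulrA.
rewrite -mulr_sumr; congr (_ * _); rewrite /ssep_generator.
under eq_bigr => eta' _ do rewrite mulrBr.
under [RHS]eq_bigr => eta' _ do rewrite mulrBl.
rewrite !sumrB; congr (_ - _); rewrite -[LHS]mulr_suml.
rewrite [RHS](bigD1 eta) //= eqxx mul1r [X in _ + X]big1 ?addr0 // => eta' /negPf ne.
by rewrite eq_sym ne !mul0r.
Qed.

Lemma sum_indicator (b : bool) eta h :
  \sum_eta' (b && (eta' == eta))%:R * h eta' = b%:R * h eta :> R.
Proof.
rewrite (bigD1 eta) //= eqxx andbT big1 ?addr0 // => eta' /negPf ->.
by rewrite andbF mul0r.
Qed.

Lemma sum_ssep_rate eta h :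
  \sum_eta' rate eta eta' * h eta' =
  \sum_i \sum_(j | neighbours i j) (eta i && ~~ eta j)%:R * h (jump eta i j)
  + \sum_(i < N | i == 0 :> nat)
      (alpha * (~~ eta i)%:R * h (set_site eta i true)
       + gamma * (eta i)%:R * h (set_site eta i false))
  + \sum_(i < N | i.+1 == N)
      (delta * (~~ eta i)%:R * h (set_site eta i true)
       + beta * (eta i)%:R * h (set_site eta i false)).
Proof.
have boundary (P : pred 'I_N) (p m : R) :
    \sum_eta' (\sum_(i < N | P i) (p * (~~ eta i && (eta' == set_site eta i true))%:R
      + m * (eta i && (eta' == set_site eta i false))%:R)) * h eta' =
    \sum_(i < N | P i) (p * (~~ eta i)%:R * h (set_site eta i true)
       + m * (eta i)%:R * h (set_site eta i false)).
  under eq_bigr => eta' _ do rewrite mulr_suml.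
  rewrite exchange_big /=; apply: eq_bigr => i _.
  under eq_bigr => eta' _ do rewrite mulrDl -!mulrA.
  by rewrite big_split /= -!mulr_sumr !sum_indicator !mulrA.
rewrite -2!boundary -addrA -[X in _ = _ + X]big_split /=.
transitivity (\sum_eta' ((\sum_i \sum_(j | neighbours i j)
    [&& eta i, ~~ eta j & eta' == jump eta i j]%:R * h eta')
   + (rate eta eta' - \sum_i \sum_(j | neighbours i j)
    [&& eta i, ~~ eta j & eta' == jump eta i j]%:R) * h eta')).
  apply: eq_bigr => eta' _; rewrite mulrBl addrC mulr_suml.
  under [X in _ - X]eq_bigr => i _ do rewrite mulr_suml.
  by rewrite subrK.
rewrite big_split /=; congr (_ + _).
  rewrite exchange_big /=; apply: eq_bigr => i _.
  rewrite exchange_big /=; apply: eq_bigr => j _.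
  by under eq_bigr => eta' _ do rewrite andbA; rewrite sum_indicator.
apply: eq_bigr => eta' _; rewrite -mulrDl /ssep_rate; congr (_ * _); ring.
Qed.

Variable rho : R.

Definition site_prod S eta : R := \prod_(i in S) ((eta i)%:R - rho).

Lemma site_prod_swap i j S eta :
  site_prod (swap i j S) eta = \prod_(k in S) ((eta (tperm i j k))%:R - rho).
Proof. by rewrite /site_prod big_imset //= => k l _ _; exact: perm_inj. Qed.

(** Jumps from i to j and from j to i together have the effect of exchanging the contents of
    i and j, as nothing changes when both sites are in the same state. *)
Lemma site_prod_jump i j S eta : neighbours i j ->
  (eta i && ~~ eta j)%:R * (site_prod S (jump eta i j) - site_prod S eta)
  + (eta j && ~~ eta i)%:R * (site_prod S (jump eta j i) - site_prod S eta)
  = site_prod (swap i j S) eta - site_prod S eta.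
Proof.
move=> nij; have ij : i != j.
  by apply: contraTneq nij => ->; rewrite /neighbours; lia.
have jumpE k l : k != l -> eta k -> ~~ eta l ->
    site_prod S (jump eta k l) = site_prod (swap k l S) eta.
  move=> kl ek el; rewrite site_prod_swap; apply: eq_bigr => m _; congr (_%:R - _).
  rewrite !ffunE; case: tpermP => [->|->|/eqP/negPf mk /eqP/negPf ml].
  - by rewrite (negPf kl) eqxx (negPf el).
  - by rewrite eqxx ek.
  - by rewrite mk ml.
case ei: (eta i); case ej: (eta j); rewrite /= ?mul0r ?mul1r ?addr0 ?add0r.
- rewrite site_prod_swap; apply/esym/eqP; rewrite subr_eq0; apply/eqP.
  by apply: eq_bigr => k _; case: tpermP => [->|->|//]; rewrite ei ej.
- by rewrite jumpE ?ei ?ej.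
- by rewrite jumpE ?ei ?ej // 1?eq_sym // swapC.
- rewrite site_prod_swap; apply/esym/eqP; rewrite subr_eq0; apply/eqP.
  by apply: eq_bigr => k _; case: tpermP => [->|->|//]; rewrite ei ej.
Qed.

(** Creation at rate p and annihilation at rate m drive the occupation number towards
    p / (p + m) at rate p + m. *)
Lemma site_prod_set_site p m i S eta : p + m != 0 ->
  p * (~~ eta i)%:R * (site_prod S (set_site eta i true) - site_prod S eta)
  + m * (eta i)%:R * (site_prod S (set_site eta i false) - site_prod S eta)
  = if i \in S then
      - ((p + m) * (site_prod S eta - (p / (p + m) - rho) * site_prod (S :\ i) eta))
    else 0.
Proof.
move=> pm0; case: ifP => Si; last first.
  have E b : site_prod S (set_site eta i b) = site_prod S eta.
    apply: eq_bigr => k Sk; rewrite ffunE; case: eqP => // ki.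
    by rewrite -ki Sk in Si.
  by rewrite !E !subrr !mulr0 addr0.
have E b : site_prod S (set_site eta i b) = (b%:R - rho) * site_prod (S :\ i) eta.
  rewrite /site_prod (big_setD1 i) //= ffunE eqxx; congr (_ * _).
  by apply: eq_bigr => k /[!inE]/andP[/negPf ki _]; rewrite ffunE ki.
have -> : site_prod S eta = ((eta i)%:R - rho) * site_prod (S :\ i) eta.
  by rewrite /site_prod (big_setD1 i).
by rewrite !E; case: (eta i) => /=; field.
Qed.

Definition centred_moment S : R := \sum_eta mu eta * site_prod S eta.

Lemma centred_moment_equation S :
  ssep_steady_state alpha beta gamma delta mu ->
  alpha + gamma != 0 -> beta + delta != 0 -> rho = delta / (beta + delta) ->
  moment_equation (alpha + gamma) (beta + delta) (alpha / (alpha + gamma) - rho)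
    centred_moment S.
Proof.
move=> st left0 right0 rhoE; rewrite /moment_equation.
have := steady_state_generator (site_prod S) st.
under eq_bigr => eta _.
  rewrite (sum_ssep_rate eta (fun eta' => site_prod S eta' - site_prod S eta)).
  under [X in _ + X + _]eq_bigr => i _ do rewrite site_prod_set_site //.
  under [X in _ + _ + X]eq_bigr => i _ do rewrite site_prod_set_site 1?addrC //.
  over.
move=> E.
pose V eta := \sum_i \sum_(j | neighbours i j)
  (eta i && ~~ eta j)%:R * (site_prod S (jump eta i j) - site_prod S eta).
have VE : \sum_i \sum_(j | neighbours i j) (centred_moment (swap i j S) - centred_moment S)
    = 2 * \sum_eta mu eta * V eta.
  pose F i j := \sum_eta mu eta *
    ((eta i && ~~ eta j)%:R * (site_prod S (jump eta i j) - site_prod S eta)).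
  transitivity (\sum_i \sum_(j | neighbours i j) (F i j + F j i)).
    apply: eq_bigr => i _; apply: eq_bigr => j nij.
    rewrite /F /centred_moment -sumrB -big_split /=; apply: eq_bigr => eta _.
    by rewrite -mulrBr -(site_prod_jump _ _ nij) mulrDr.
  rewrite (eq_bigr _ (fun i _ => big_split _ _ _ _ _)) big_split /=.
  rewrite -[X in _ + X]sum_neighboursC mulr2n mulrDl mul1r; congr (_ + _);
    rewrite /V /F; (under [RHS]eq_bigr => eta _ do rewrite mulr_sumr);
    rewrite [RHS]exchange_big /=; apply: eq_bigr => i _;
    (under [RHS]eq_bigr => eta _ do rewrite mulr_sumr);
    by rewrite [RHS]exchange_big.
rewrite VE; congr (_ * _).
have boundary (P : pred 'I_N) (a c : R) :
    \sum_(i < N | P i && (i \in S)) a * (centred_moment S - c * centred_moment (S :\ i))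
    = - \sum_eta mu eta * \sum_(i < N | P i)
        (if i \in S then - (a * (site_prod S eta - c * site_prod (S :\ i) eta)) else 0).
  rewrite big_mkcondr /= -sumrN.
  under [RHS]eq_bigr => eta _ do rewrite -mulrN -sumrN mulr_sumr.
  rewrite [RHS]exchange_big /=; apply: eq_bigr => i _.
  case: ifP => _; last by rewrite big1 // => eta _; rewrite oppr0 mulr0.
  rewrite /centred_moment mulr_sumr -sumrB mulr_sumr; apply: eq_bigr => eta _; ring.
have last_site : \sum_(i < N | (i.+1 == N) && (i \in S)) (beta + delta) * centred_moment S
    = \sum_(i < N | (i.+1 == N) && (i \in S)) (delta + beta) *
       (centred_moment S - (delta / (delta + beta) - rho) * centred_moment (S :\ i)).
  apply: eq_bigr => i _; rewrite rhoE [delta + beta]addrC subrr mul0r subr0 //.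
rewrite last_site !boundary.
move: E; under eq_bigr => eta _ do rewrite !mulrDr.
rewrite !big_split /= => E; apply/eqP; rewrite -subr_eq0; apply/eqP; rewrite -[RHS]E.
by rewrite opprD !opprK addrA [delta + beta]addrC.
Qed.

End SteadyState.

(** * Size of the factors of the product formula *)

Section FactorBounds.
Variables (R : realFieldType).

Lemma slow_scale (e : R) J p K d D f : 0 <= e -> 0 <= K -> `|d| * e <= D ->
  slow e J p.+1 K f -> slow e J p (K * D) (fun j => d * f j).
Proof.
move=> e0 K0 dD; elim: J p f => [|J IH] p f [f0 H]; split=> //.
- rewrite normrM; apply: le_trans (ler_wpM2l (normr_ge0 d) f0) _.
  rewrite exprS (_ : `|d| * _ = `|d| * e * (K * e ^+ p)); last by ring.
  by rewrite [K * D]mulrC -[D * K * _]mulrA ler_wpM2r // mulr_ge0 ?exprn_ge0.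
- rewrite normrM; apply: le_trans (ler_wpM2l (normr_ge0 d) f0) _.
  rewrite exprS (_ : `|d| * _ = `|d| * e * (K * e ^+ p)); last by ring.
  by rewrite [K * D]mulrC -[D * K * _]mulrA ler_wpM2r // mulr_ge0 ?exprn_ge0.
- case: H => f1 f2; split; first exact: IH f1.
  by apply: eq_slow (IH _ _ f2) => j; rewrite mulrBr.
Qed.

(** The difference of 1 / (L - j) is the product of two consecutive terms of the same
    sequence, so [slowM] gives the induction on T. *)
Lemma slow_inv T (m : R) : 0 < m -> exists2 K : R, 0 <= K &
  forall e : R, 0 < e -> forall L : R,
  (forall j, (j <= T)%N -> m <= e * (L - j%:R)) ->
  slow e T 1 K (fun j => (L - j%:R)^-1).
Proof.
move=> m0; have base (e L : R) : 0 < e -> m <= e * (L - 0%:R) -> `|(L - 0%:R)^-1| <= m^-1 * e ^+ 1.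
  move=> e0; rewrite subr0 => mL; have L0 : 0 < L by rewrite -(pmulr_rgt0 _ e0); apply: lt_le_trans mL.
  rewrite gtr0_norm ?invr_gt0 // expr1 -ler_pdivrMr // -invfM lef_pV2 ?posrE ?mulr_gt0 //.
  by rewrite mulrC.
elim: T => [|T [K K0 HK]].
  exists m^-1 => [|e e0 L HL]; first by rewrite invr_ge0 ltW.
  by split=> //; apply: base => //; exact: HL.
have L0 : 0 <= 2 ^+ T * (K * K) by rewrite !mulr_ge0 ?exprn_ge0.
have m'0 : 0 <= m^-1 by rewrite invr_ge0 ltW.
exists (m^-1 + K + 2 ^+ T * (K * K)) => [|e e0 L HL]; first by rewrite !addr_ge0.
have HK0 : slow e T 1 K (fun j => (L - j%:R)^-1).
  by apply: HK => // j jT; apply: HL; rewrite leqW.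
have HK1 : slow e T 1 K (fun j => (L - j.+1%:R)^-1).
  apply: (@eq_slow _ _ _ _ _ (fun j => (L - 1 - j%:R)^-1)) => [j|].
    by rewrite -natr1; congr (_^-1); ring.
  apply: HK => // j jT; have := HL j.+1 jT; rewrite -natr1.
  by congr (_ <= e * _); ring.
split; [|split].
- apply: le_trans (base e L e0 (HL 0%N isT)) _.
  by rewrite ler_wpM2r ?exprn_ge0 ?(ltW e0) // -addrA lerDl addr_ge0.
- apply: slow_leK HK1; first exact: ltW.
  by rewrite addrAC lerDr addr_ge0.
- apply: (@slow_leK _ _ (ltW e0) _ _ (2 ^+ T * (K * K))); first by rewrite lerDr addr_ge0.
  have := slowM (ltW e0) K0 K0 HK0 HK1; rewrite addn1; apply: eq_in_slow => j jT.
  have pos k : (k <= T.+1)%N -> L - k%:R != 0.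
    by move=> /HL /(lt_le_trans m0); rewrite pmulr_rgt0 // => /lt0r_neq0.
  have := pos j.+1 jT; have := pos j (leqW jT); rewrite -natr1 => p1 p2.
  by field; rewrite p1 p2.
Qed.

(** Written as c - c (i + a) / (L - j): the numerator is of order N and the quotient 1 / (L - j)
    of order 1 / N.  The condition n < N keeps L - j away from 0, even for small N. *)
Lemma ssep_factor_slow (a b : R) n : 0 < a -> 0 < b -> exists2 K : R, 0 <= K &
  forall N (c : R), (n < N)%N -> `|c| <= 1 -> forall i : 'I_N,
  slow (N%:R^-1) n 0 K (fun j => ssep_factor a b c j i).
Proof.
move=> a0 b0; pose m := (a + b) / (n.+1%:R + (a + b)).
have n0 : 0 < n.+1%:R :> R by rewrite ltr0n.
have m0 : 0 < m by rewrite divr_gt0 // ?addr_gt0.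
have [K K0 HK] := slow_inv n m0.
exists (1 + K * (1 + a)) => [|N c ltnN c1 i]; first by rewrite !(addr_ge0, mulr_ge0) // ltW.
have N0 : 0 < N%:R :> R by rewrite ltr0n; apply: leq_ltn_trans ltnN.
have N1 : 1 <= N%:R :> R by rewrite ler1n; apply: leq_ltn_trans ltnN.
have e0 : 0 < N%:R^-1 :> R by rewrite invr_gt0.
(* For n < N, the ratio (L - n) / N is at least (a + b) / (n + 1 + a + b). *)
have HL j : (j <= n)%N -> m <= N%:R^-1 * (ssep_length N a b - j%:R).
  move=> jn; rewrite ler_pdivlMl // /m mulrA ler_pdivrMr ?addr_gt0 // /ssep_length.
  have : j%:R <= n%:R :> R by rewrite ler_nat.
  have : n.+1%:R <= N%:R :> R by rewrite ler_nat.
  rewrite -natr1; have := ler0n R n; have s0 := addr_gt0 a0 b0; move: s0.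
  rewrite -[_ + a + b]addrA; move: (a + b) (N%:R : R) (n%:R : R) (j%:R : R) => s x y z s0 y0 yx zy.
  have p1 : 0 <= (x - (y + 1)) * (y + 1) by apply: mulr_ge0; lra.
  have p2 : 0 <= (y - z) * (y + 1 + s) by apply: mulr_ge0; lra.
  have p3 : 0 <= s * s by rewrite mulr_ge0 ?ltW.
  lra.
apply: (@eq_in_slow _ _ _ _ _ (fun j => c + - (c * (i%:R + a)) * (ssep_length N a b - j%:R)^-1)) => [j jn|].
  have : ssep_length N a b - j%:R != 0.
    by have := lt_le_trans m0 (HL j jn); rewrite pmulr_rgt0 // => /lt0r_neq0.
  rewrite /ssep_factor /site_height /ssep_length => p; by field.
apply: slowD; first exact: (slow_const (ltW e0)).
apply: (slow_scale (ltW e0) K0); last exact: HK.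
rewrite normrN normrM; apply: (@le_trans _ _ ((i%:R + a) * N%:R^-1)).
  have ia0 : 0 <= i%:R + a by rewrite addr_ge0 ?ler0n ?(ltW a0).
  by rewrite ler_wpM2r ?(ltW e0) // (ger0_norm ia0) ler_piMl.
rewrite mulrDl lerD // ?ler_pdivrMr // ?mul1r ?ler_nat ?(ltnW (ltn_ord i)) //.
by rewrite ler_peMr ?(ltW a0).
Qed.

End FactorBounds.

(** * Cumulants of the occupation variables *)

Section Multiplicative.
Variables (R : comNzRingType) (I : finType).

Definition multiplicative (u : I -> R) : setfun R I := [ffun S : {set I} => \prod_(i in S) u i].

(** Expansion of the product of the u i + v i over i in S. *)
Lemma multiplicativeM u v :
  multiplicative u * multiplicative v = multiplicative (fun i => u i + v i).
Proof.
apply/ffunP => S; rewrite convE ffunE.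
(* Outside S the factor 0 + 1 forces the expansion to range over the subsets of S. *)
pose F i := if i \in S then u i else 0; pose G i := if i \in S then v i else 1.
have -> : \prod_(i in S) (u i + v i) = \prod_i (F i + G i).
  rewrite big_mkcond; apply: eq_bigr => i _; rewrite /F /G.
  by case: (i \in S); rewrite ?add0r.
rewrite bigA_distr [RHS](bigID (fun C : {set I} => C \subset S)) /= [X in _ + X]big1 ?addr0.
  apply: eq_bigr => C sCS; rewrite !ffunE [RHS](bigID (mem C)) /=; congr (_ * _).
    by apply: eq_big => // i Ci; rewrite Ci /F (subsetP sCS).
  rewrite big_mkcond [RHS]big_mkcond; apply: eq_bigr => i _; rewrite /G !inE.
  by case: (i \in C); case: (i \in S).
move=> C /subsetPn[i Ci Si]; rewrite (bigD1 i) //= Ci /F (negPf Si) mul0r //.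
Qed.

End Multiplicative.

Section SiteMoments.
Variables (R : realType) (alpha beta gamma delta : R).
Hypotheses (alpha_ge0 : 0 <= alpha) (beta_ge0 : 0 <= beta).
Hypotheses (gamma_ge0 : 0 <= gamma) (delta_ge0 : 0 <= delta).
Hypotheses (left_gt0 : 0 < alpha + gamma) (right_gt0 : 0 < beta + delta).

Local Notation a := (alpha + gamma)^-1.
Local Notation b := (beta + delta)^-1.
Local Notation rho := (delta / (beta + delta)).
Local Notation c := (alpha / (alpha + gamma) - rho).
Local Notation steady := (ssep_steady_state alpha beta gamma delta).

Definition site_moment N (mu : config N -> R) (S : {set 'I_N}) : R :=
  \sum_eta mu eta * \prod_(i in S) (eta i)%:R.

Lemma site_moment_ge0_le1 N (mu : config N -> R) S : steady mu -> 0 <= site_moment mu S <= 1.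
Proof.
case=> mu0 mu1 _; have prod01 (eta : config N) : 0 <= \prod_(i in S) ((eta i)%:R : R) <= 1.
  by rewrite prodr_ge0 ?prodr_ile1 // => i _; case: (eta i); rewrite ?ler01 ?lexx.
apply/andP; split.
  by apply: sumr_ge0 => eta _; rewrite mulr_ge0 //; case/andP: (prod01 eta).
by rewrite -[leRHS]mu1; apply: ler_sum => eta _; rewrite ler_piMr //; case/andP: (prod01 eta).
Qed.

(** Both densities lie in [0, 1]. *)
Lemma density_gap_le1 : `|c| <= 1.
Proof.
have A : 0 <= alpha / (alpha + gamma) <= 1.
  by rewrite divr_ge0 ?(ltW left_gt0) //= ler_pdivrMr // mul1r lerDl.
have B : 0 <= rho <= 1.
  by rewrite divr_ge0 ?(ltW right_gt0) //= ler_pdivrMr // mul1r lerDr.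
move: A B => /andP[? ?] /andP[? ?]; rewrite ler_norml; apply/andP; split; lra.
Qed.

(** Both sides solve the same linear system and equal 1 at the empty set. *)
Lemma centred_momentE N (mu : config N -> R) S : steady mu ->
  centred_moment mu rho S = ssep_moment a b c S.
Proof.
move=> st; apply/eqP; rewrite -subr_eq0; apply/eqP.
apply: (@moment_equation_homogeneous _ _ _ _ c left_gt0 right_gt0
  (fun S => centred_moment mu rho S - ssep_moment a b c S)) => [|T].
  rewrite /ssep_moment ranked_prod0 /centred_moment; case: st => _ <- _.
  apply/eqP; rewrite subr_eq0; apply/eqP; apply: eq_bigr => eta _.
  by rewrite /site_prod big_set0 mulr1.
apply: moment_equationB; first by apply: centred_moment_equation => //; exact: lt0r_neq0.
have := @ssep_moment_equation _ N a b c _ _ T; rewrite !invrK; apply; by rewrite invr_gt0.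
Qed.

(** The mixed moments of the variables tau (B k), where B may take the same value several
    times: as tau is {0,1}-valued only the set of values matters. *)
Definition image_moments N (mu : config N -> R) (I : finType) (B : I -> 'I_N) : setfun R I :=
  [ffun C : {set I} => site_moment mu (B @: C)].

(** Orders the positions by site, breaking ties arbitrarily so that the order is strict
    even when B is not injective. *)
Definition tie_key N (I : finType) (B : I -> 'I_N) (k : I) : nat :=
  (B k * #|I| + enum_rank k)%N.

Lemma tie_key_inj N (I : finType) (B : I -> 'I_N) : injective (tie_key B).
Proof.
move=> k l E; apply/enum_rank_inj/val_inj => /=; have := congr1 (modn^~ #|I|) E.
by rewrite /tie_key !modnMDl !modn_small.
Qed.

Lemma tie_key_lt N (I : finType) (B : I -> 'I_N) k l : B k != B l ->
  (tie_key B k < tie_key B l)%N = (B k < B l)%N.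
Proof.
move=> ne; have [ltB|leB] := ltnP (B k) (B l).
  apply: (@leq_trans ((B k).+1 * #|I|)%N); first by rewrite /tie_key mulSn addnC ltn_add2r.
  by apply: leq_trans (leq_addr _ _); rewrite leq_mul2r ltB orbT.
apply/negbTE; rewrite -leqNgt ltnW //.
have ltB : (B l < B k)%N by rewrite ltn_neqAle leB andbT eq_sym.
apply: (@leq_trans ((B l).+1 * #|I|)%N); first by rewrite /tie_key mulSn addnC ltn_add2r.
by apply: leq_trans (leq_addr _ _); rewrite leq_mul2r ltB orbT.
Qed.

(** Expands the product of the sigma + rho inside the expectation. *)
Lemma image_moments_shift N (mu : config N -> R) (I : finType) (B : I -> 'I_N) (C : {set I}) :
  {in C &, injective B} ->
  image_moments mu B C =
   (([ffun D : {set I} => centred_moment mu rho (B @: D)] : setfun R I)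
     * power_setfun I rho) C.
Proof.
move=> injB.
pose u (eta : config N) k : R := (eta (B k))%:R - rho.
have -> : power_setfun I rho = multiplicative (fun=> rho).
  by apply/ffunP => D; rewrite !ffunE prodr_const.
rewrite convE ffunE /site_moment.
transitivity (\sum_(D : {set I} | D \subset C) \sum_eta mu eta *
    (multiplicative (u eta) D * multiplicative (fun=> rho) (C :\: D))); last first.
  apply: eq_bigr => D sDC; rewrite [in RHS]ffunE /centred_moment mulr_suml; apply: eq_bigr => eta _.
  rewrite mulrA; congr (_ * _ * _); rewrite ffunE /site_prod big_imset //.
  by move=> k l Dk Dl; apply: injB; apply: (subsetP sDC).
rewrite exchange_big /=; apply: eq_bigr => eta _; rewrite -mulr_sumr -convE multiplicativeM.
rewrite ffunE big_imset //=; congr (_ * _); apply: eq_bigr => k _; by rewrite subrK.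
Qed.

Lemma ssep_moment_image N (I : finType) (B : I -> 'I_N) (C : {set I}) : {in C &, injective B} ->
  ssep_moment a b c (B @: C) =
  ranked_prod (tie_key B) (fun j k => ssep_factor a b c j (B k)) 0 C.
Proof.
move=> injB; rewrite /ssep_moment !ffunE big_imset //=; apply: eq_bigr => k Ck.
congr (ssep_factor _ _ _ (_ + _)%N _); rewrite /rank_above.
rewrite (_ : [set l in B @: C | _] = B @: [set l in C | (tie_key B k < tie_key B l)%N]).
  by rewrite card_in_imset // => l m /[!inE]/andP[Cl _]/andP[Cm _]; exact: injB.
apply/setP => i; rewrite !inE; apply/andP/imsetP => [[/imsetP[l Cl ->] lt]|[l /[!inE]/andP[Cl lt] ->]].
  by exists l => //; rewrite inE Cl tie_key_lt // neq_ltn lt.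
rewrite imset_f //; split=> //; rewrite -tie_key_lt //.
by apply: contraTneq lt => /injB -> //; rewrite ltnn.
Qed.

(** The centred moments are ranked products for the order of the sites, so
    [exists_cumul_bound] applies with T = n, the largest rank that occurs. *)
Lemma cumul_distinct_bound n : exists2 K, 0 <= K &
  forall N (mu : config N -> R), steady mu ->
  forall (I : finType) (B : I -> 'I_N) (S : {set I}),
  #|S| = n.+1 -> {in S &, injective B} ->
  `|cumul (image_moments mu B) S| <= K * N%:R^-1 ^+ n.
Proof.
case: n => [|n].
  exists 1 => // N mu st I B S /eqP/cards1P[k ->] _; rewrite cumul_set1 ffunE mulr1.
  by have /andP[? ?] := site_moment_ge0_le1 (B @: [set k]) st; rewrite ger0_norm.
have a0 : 0 < a by rewrite invr_gt0.
have b0 : 0 < b by rewrite invr_gt0.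
have [K0 K0_ge0 slowK0] := ssep_factor_slow n.+1 a0 b0.
have [K K_ge0 HK] := exists_cumul_bound K0_ge0 (leqnn n.+2).
exists K => // N mu st I B S cardS injB.
have injC (C : {set I}) : C \subset S -> {in C &, injective B}.
  by move=> sCS k l Ck Cl; apply: injB; apply: (subsetP sCS).
have ltnN : (n.+1 < N)%N by rewrite -cardS -(card_in_imset injB) -[X in (_ <= X)%N]card_ord max_card.
pose g : setfun R I := [ffun D : {set I} => centred_moment mu rho (B @: D)].
have g0 : g set0 = 1.
  by rewrite ffunE imset0 centred_momentE // /ssep_moment ranked_prod0.
(* A cumulant at S depends on the moments of subsets of S only, where B is injective. *)
rewrite (@eq_cumul _ _ _ (g * power_setfun I rho)) => [|C sCS]; last first.
  by rewrite image_moments_shift //; exact: injC.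
rewrite cumul_shift ?cardS // (@eq_cumul _ _ _
    (ranked_prod (tie_key B) (fun j k => ssep_factor a b c j (B k)) 0)) => [|C sCS]; last first.
  by rewrite ffunE centred_momentE // ssep_moment_image //; exact: injC.
have N0 : 0 < N%:R :> R by rewrite ltr0n; apply: leq_ltn_trans ltnN.
have := HK N%:R^-1 _ I (tie_key B) (fun j k => ssep_factor a b c j (B k))
  (tie_key_inj (B := B)) _ S.
rewrite cardS leqnn subnn => /(_ _ _ isT)/slow0E; apply.
- by rewrite invr_ge0 ltW.
- by move=> k; apply: slowK0 => //; exact: density_gap_le1.
Qed.

(** By induction on the number of positions, with [cumul_distinct_bound] when the sites are
    distinct.  Otherwise two positions i and j carry the same site; in each product given by
    [cumul_dup] that site occurs in both factors, so the two factors together have at least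
    one more distinct site than S, which compensates for the additional exponent - 1. *)
Lemma cumul_image_bound n : exists2 K, 0 <= K &
  forall N (mu : config N -> R), steady mu ->
  forall (I : finType) (B : I -> 'I_N) (S : {set I}), (0 < #|S| <= n)%N ->
  `|cumul (image_moments mu B) S| <= K * N%:R^-1 ^+ #|B @: S|.-1.
Proof.
elim: n => [|n [K K0 HK]].
  by exists 0 => // N mu st I B S /andP[S0]; rewrite leqNgt S0.
have [Kd Kd0 HKd] := cumul_distinct_bound n.
have L0 : 0 <= K * K *+ 2 ^ n.+1 by rewrite mulrn_wge0 // mulr_ge0.
exists (Kd + K + K * K *+ 2 ^ n.+1) => [|N mu st I B S /andP[S0]]; first by rewrite !addr_ge0.
have e0 : 0 <= N%:R^-1 :> R by rewrite invr_ge0 ler0n.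
have N_gt0 : (0 < N)%N by case/card_gt0P: S0 => k _; apply: leq_ltn_trans (ltn_ord (B k)).
have e1 : N%:R^-1 <= 1 :> R by rewrite invf_le1 ?ltr0n // ler1n.
rewrite leq_eqVlt => /orP[/eqP cardS|]; last first.
  rewrite ltnS => leSn; apply: le_trans (HK N mu st I B S _) _; first by rewrite S0.
  by rewrite ler_wpM2r ?exprn_ge0 // addrAC lerDr addr_ge0.
have [/dinjectiveP injB|/dinjectivePn[i Si [j /andP[ji Sj] Bij]]] := boolP (dinjectiveb B S).
  apply: le_trans (HKd N mu st I B S cardS injB) _; rewrite card_in_imset // cardS /=.
  by rewrite ler_wpM2r ?exprn_ge0 // -addrA lerDl addr_ge0.
have f0 : image_moments mu B set0 = 1.
  rewrite ffunE imset0 /site_moment; under eq_bigr do rewrite big_set0 mulr1.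
  by case: st.
have imD (C : {set I}) : i \in C -> j \in C -> B @: (C :\ j) = B @: C.
  move=> Ci Cj; apply/eqP; rewrite eqEsubset imsetS ?subD1set //=.
  apply/subsetP => _ /imsetP[k Ck ->]; have [->|kj] := eqVneq k j.
    by rewrite -Bij imset_f // !inE eq_sym ji.
  by rewrite imset_f // !inE kj.
rewrite (cumul_dup (i := i) (j := j)) // 1?eq_sym //; last first.
  by move=> C Ci Cj; rewrite !ffunE imD.
set p := #|B @: S|.-1.
have cardSj : #|S :\ j| = n by move: cardS; rewrite (cardsD1 j S) Sj => -[].
have HSj : `|cumul (image_moments mu B) (S :\ j)| <= K * N%:R^-1 ^+ p.
  rewrite /p -(imD S Si Sj); apply: HK => //; rewrite cardSj leqnn andbT -cardSj.
  by apply/card_gt0P; exists i; rewrite !inE eq_sym ji.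
have Hsum : `|\sum_(C : {set I} | [&& C \subset S, i \in C & j \notin C])
    cumul (image_moments mu B) C * cumul (image_moments mu B) (S :\: C)|
    <= K * K *+ 2 ^ n.+1 * N%:R^-1 ^+ p.
  apply: le_trans (ler_norm_sum _ _ _) _.
  pose P := [pred C : {set I} | [&& C \subset S, i \in C & j \notin C]].
  apply: (@le_trans _ _ (\sum_(C in P) K * K * N%:R^-1 ^+ p)); last first.
    rewrite sumr_const mulrnAl; apply: ler_wpMn2l; first by rewrite !mulr_ge0 ?exprn_ge0.
    rewrite -cardS -card_powerset; apply: subset_leq_card.
    by apply/subsetP => C; rewrite !inE => /andP[].
  apply: ler_sum => C /and3P[sCS Ci Cj]; rewrite normrM.
  have Dj : j \in S :\: C by rewrite inE Cj.
  have C0 : (0 < #|C|)%N by apply/card_gt0P; exists i.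
  have D0 : (0 < #|S :\: C|)%N by apply/card_gt0P; exists j.
  have cardCD : (#|S :\: C| + #|C| = n.+1)%N by rewrite cardsD (setIidPr sCS) subnK ?subset_leq_card.
  apply: (@le_trans _ _ (K * N%:R^-1 ^+ #|B @: C|.-1 * (K * N%:R^-1 ^+ #|B @: (S :\: C)|.-1))).
    have Cn : (#|C| <= n)%N by rewrite -ltnS -cardCD addnC -[X in (X < _)%N]addn0 ltn_add2l.
    have Dn : (#|S :\: C| <= n)%N by rewrite -ltnS -cardCD -[X in (X < _)%N]addn0 ltn_add2l.
    apply: ler_pM; rewrite ?normr_ge0 //; apply: HK => //; apply/andP; split; by [].
  rewrite mulrACA -exprD ler_wpM2l ?mulr_ge0 // ler_wiXn2l //.
  have : (#|B @: S| < #|B @: C| + #|B @: (S :\: C)|)%N.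
    have CU : C :|: S :\: C = S by rewrite -{1}(setIidPr sCS) setID.
    rewrite -cardsUI -imsetU CU -[X in (X < _)%N]addn0 ltn_add2l.
    by apply/card_gt0P; exists (B i); rewrite inE imset_f // Bij imset_f.
  have : (0 < #|B @: C|)%N by apply/card_gt0P; exists (B i); rewrite imset_f.
  have : (0 < #|B @: (S :\: C)|)%N by apply/card_gt0P; exists (B j); rewrite imset_f.
  rewrite /p; move: #|B @: S| #|B @: C| #|B @: (S :\: C)|; clear; lia.
apply: le_trans (ler_normB _ _) _; rewrite !mulrDl.
have : 0 <= Kd * N%:R^-1 ^+ p by rewrite mulr_ge0 ?exprn_ge0.
move: HSj Hsum => H1 H2 H3; rewrite -addrA ler_wpDl //; exact: lerD.
Qed.

End SiteMoments.

(** * Expectations in terms of the steady state *)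

Section Expectation.
Variables (d : measure_display) (T : measurableType d) (R : realType).
Variables (P : probability T R) (N : nat) (tau : 'I_N -> {RV P >-> R}).
Variable mu : config N -> R.
Hypotheses (tauP : distributed_as P tau mu) (mu1 : \sum_eta mu eta = 1).

Local Open Scope classical_set_scope.

Definition cylinder (eta : config N) : set T := [set w | forall i, tau i w = (eta i)%:R].

Lemma measurable_cylinder eta : measurable (cylinder eta).
Proof.
rewrite (_ : cylinder eta = \bigcap_(i in [set: 'I_N]) (tau i @^-1` [set (eta i)%:R])).
  apply: fin_bigcap_measurable => [|i _]; first exact: finite_finset.
  rewrite -[X in measurable X]classical_sets.setTI.
  by apply: (measurable_funPT (tau i)).
by apply/seteqP; split => [w tw i _|w tw i]; [exact: tw | exact: (tw i I)].
Qed.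

Lemma trivIset_cylinder (D : set (config N)) : classical_sets.trivIset D cylinder.
Proof.
move=> eta eta' _ _ [w [tw tw']]; apply/ffunP => i.
have := tw i; rewrite (tw' i); case: (eta i) (eta' i) => [] [] // /eqP.
  by rewrite eq_sym oner_eq0.
by rewrite oner_eq0.
Qed.

(** The cylinders are disjoint and have total mass 1, so the integral is carried by them,
    and f is constant on each. *)
Lemma expectation_distributed (f : T -> R) (g : config N -> R) :
  measurable_fun [set: T] f -> (forall eta w, cylinder eta w -> f w = g eta) ->
  ('E_P[f] = (\sum_eta mu eta * g eta)%:E)%E.
Proof.
move=> mf fg; rewrite unlock.
set D := \big[classical_sets.setU/classical_sets.set0]_(eta <- index_enum (config N)) cylinder eta.
have mD : measurable D by apply: bigsetU_measurable => eta _; exact: measurable_cylinder.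
have PD : P D = 1%E.
  rewrite /D -classical_sets.bigcup_seq measure_fin_bigcup //; last by move=> eta _; exact: measurable_cylinder.
    rewrite -fsbig_seq ?index_enum_uniq //= -mu1 -sumEFin; apply: eq_bigr => eta _; exact: tauP.
  exact: trivIset_cylinder.
have /measurable_EFinP mEf := mf.
transitivity (\int[P]_(w in D) (f w)%:E)%E.
  rewrite [RHS]integral_mkcond; apply: ae_eq_integral => //.
    by apply/(measurable_restrictT _ _).1 => //; exact: measurable_funTS.
  exists (~` D); split; first exact: measurableC.
    by rewrite [LHS]probability_setC // PD subee.
  move=> w /= H Dw; apply: H => _; rewrite /patch mem_set //.
rewrite integral_bigsetU_EFin //=.
- rewrite -sumEFin; apply: eq_bigr => eta _.
  rewrite (eq_integral (cst (g eta)%:E)) => [|w]; last by rewrite in_setE => /fg /= ->.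
  rewrite integral_cst; last exact: measurable_cylinder.
  by rewrite EFinM muleC; congr (_ * _)%E; exact: tauP.
- exact: measurable_cylinder.
- exact: index_enum_uniq.
- exact: trivIset_cylinder.
- exact: measurable_funTS.
Qed.

End Expectation.

(** * A spanning tree of the induced graph *)

Section TreeWeight.
Variables (R : realType) (N r : nat) (B : r.+1.-tuple 'I_N).

Local Notation K := (induced_wgraph (complete_wgraph R N) B).

Definition first_occurrence (i : 'I_r.+1) : 'I_r.+1 :=
  [arg min_(k < i | tnth B k == tnth B i) (k : nat)]%N.

(** Repetitions of a site hang on its first occurrence, by edges of weight 1; the first
    occurrences hang on position 0, by edges of weight 1 / N. *)
Definition parent (i : 'I_r.+1) : 'I_r.+1 :=
  if first_occurrence i == i then ord0 else first_occurrence i.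

Definition parent_tree : {set {set 'I_r.+1}} :=
  [set [set i; parent i]%SET | i in [set~ ord0]%SET]%SET.

Lemma first_occurrenceP i : tnth B (first_occurrence i) = tnth B i /\
  forall k, tnth B k = tnth B i -> (first_occurrence i <= k)%N.
Proof.
rewrite /first_occurrence; case: arg_minnP => [|k /eqP Bk kmin]; first exact: eqxx.
by split=> // l /eqP /kmin.
Qed.

Lemma parent_lt i : i != ord0 -> (parent i < i)%N.
Proof.
move=> i0; rewrite /parent; case: eqVneq => [_|fi]; first by rewrite lt0n.
by rewrite ltn_neqAle fi (first_occurrenceP i).2.
Qed.

Lemma adj_parent_tree (i j : 'I_r.+1) : (j <= i)%N -> adj parent_tree i j -> j = parent i.
Proof.
move=> leji /imsetP[k]; rewrite !inE => k0 E.
have lt := parent_lt k0.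
have : k \in [set i; j]%SET by rewrite E set21.
have : i \in [set k; parent k]%SET by rewrite -E set21.
have : j \in [set k; parent k]%SET by rewrite -E set22.
have : parent k \in [set i; j]%SET by rewrite E set22.
rewrite !inE => A1 A2 A3 A4.
have ik : i = k.
  case/orP: A3 => /eqP // A3; case/orP: A4 => /eqP A4; first by rewrite -A4.
  by move: leji; rewrite A3 -A4 leqNgt lt.
subst k; case/orP: A1 => /eqP // A1.
by move: lt; rewrite A1 ltnn.
Qed.

Lemma parent_edge_inj : {in [set~ ord0]%SET &, injective (fun i => [set i; parent i]%SET)}.
Proof.
move=> i j; rewrite !inE => i0 j0 E.
have : i \in [set j; parent j]%SET by rewrite -E set21.
have : j \in [set i; parent i]%SET by rewrite E set21.
rewrite !inE => /orP[/eqP //|/eqP ji] /orP[/eqP //|/eqP ij].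
have := parent_lt i0; have := parent_lt j0; rewrite -ij -ji => A /(ltn_trans A).
by rewrite ltnn.
Qed.

Lemma adj_parent_treeC : symmetric (adj parent_tree).
Proof. by move=> x y; rewrite /adj /= setUC. Qed.

(** Parents decrease, so every position is connected to 0; and the largest position of a
    cycle would have two distinct smaller neighbours, both equal to its parent. *)
Lemma parent_tree_spanning : spanning_tree K parent_tree.
Proof.
split.
- apply/subsetP => _ /imsetP[i i0 ->]; rewrite !inE /induced_img imsetU1 imset_set1 !cards2.
  move: i0; rewrite !inE => /parent_lt; rewrite ltn_neqAle eq_sym => /andP[-> _] /=.
  by case: (tnth B i != _).
- have root x : connect (adj parent_tree) x ord0.
    have [n] := ubnP (x : nat); elim: n x => // n IH x; rewrite ltnS => lexn.
    have [->|x0] := eqVneq x ord0; first exact: connect0.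
    apply: (connect_trans (connect1 _) (IH (parent x) _)).
      by apply/imsetP; exists x; rewrite ?inE.
    exact: leq_trans (parent_lt x0) lexn.
  by move=> x y; apply: (connect_trans (root x)); rewrite (sym_connect_sym adj_parent_treeC).
- move=> c size_c uc; have [x0 cx0] : exists x, x \in c by case: c size_c {uc} => // x; exists x; exact: mem_head.
  case: (@arg_maxnP _ x0 (mem c) (@nat_of_ord _) cx0) => m cm mmax.
  have [i s rotc] := rot_to cm.
  have {}uc : ucycle (adj parent_tree) (m :: s) by rewrite -rotc rot_ucycle.
  have {size_c}: (3 <= size (m :: s))%N by rewrite -rotc size_rot.
  have {}mmax k : k \in m :: s -> (k <= m)%N by rewrite -rotc mem_rot; exact: mmax.
  case: s uc mmax {rotc} => [|x [|z s]] // /andP[cyc un] mmax _.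
  have xm : x = parent m.
    by apply: adj_parent_tree; [apply: mmax; rewrite !inE eqxx orbT | case/andP: cyc].
  have ym : last z s = parent m.
    apply: adj_parent_tree; first by apply: mmax; rewrite inE in_cons mem_last !orbT.
    by move: cyc; rewrite /= rcons_path => /andP[_ /andP[_ /andP[_]]]; rewrite adj_parent_treeC.
  move: un => /= /andP[_ /andP[/negP xzs _]]; apply: xzs.
  by rewrite xm -ym mem_last.
Qed.

Lemma parent_tree_weight :
  N%:R^-1 ^+ #|tnth B @: [set: 'I_r.+1]%SET|.-1 <= \prod_(e in parent_tree) wt K e.
Proof.
have N0 : 0 <= N%:R^-1 :> R by rewrite invr_ge0 ler0n.
rewrite big_imset /=; last exact: parent_edge_inj.
pose F := [set i | first_occurrence i == i]%SET.
have first0 : first_occurrence ord0 = ord0.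
  by apply/val_inj/eqP; rewrite /= -leqn0; exact: ((first_occurrenceP ord0).2 ord0 erefl).
have -> : #|tnth B @: [set: 'I_r.+1]%SET| = #|F|.
  rewrite -(@card_in_imset _ _ (tnth B) F) => [|i j].
    congr #|pred_of_set _|; apply/eqP; rewrite eqEsubset [X in _ && X]imsetS ?subsetT ?andbT //.
    apply/subsetP => _ /imsetP[i _ ->]; have [Bi imin] := first_occurrenceP i.
    rewrite -Bi imset_f // inE; apply/eqP/val_inj/eqP => /=; rewrite eqn_leq.
    have [Bf fmin] := first_occurrenceP (first_occurrence i).
    by rewrite fmin // imin // Bf.
  rewrite !inE => /eqP Fi /eqP Fj Bij; apply/val_inj/eqP; rewrite /= eqn_leq.
  by rewrite -{1}Fi -{2}Fj !(first_occurrenceP _).2.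
have -> : #|F|.-1 = #|F :\ ord0| by rewrite (cardsD1 ord0 F) inE first0 eqxx.
rewrite -prodr_const big_mkcond [leRHS]big_mkcond /=; apply: ler_prod => i _.
rewrite !inE; case: eqVneq => [//|i0] /=; first by rewrite ler01 lexx.
rewrite /induced_wt /induced_img imsetU1 imset_set1 cards2.
case: ifP => [fi|/negbT fi].
  rewrite N0 /=; case: ifP => // _.
  by case: (N) => [|n]; rewrite ?invr0 ?ler01 // invf_le1 ?ltr0n // ler1n.
rewrite /parent (negPf fi) (first_occurrenceP i).1 eqxx /=; by rewrite ler01 lexx.
Qed.

Lemma max_tree_weight_ge :
  N%:R^-1 ^+ #|tnth B @: [set: 'I_r.+1]%SET|.-1 <= max_tree_weight K.
Proof.
apply: (bigmax_sup parent_tree); last exact: parent_tree_weight.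
by apply/asboolP; exact: parent_tree_spanning.
Qed.

End TreeWeight.

(** * The dependency graph *)

Section CumulantsOfSites.
Variables (d : measure_display) (T : measurableType d) (R : realType).
Variables (P : probability T R) (N : nat) (tau : 'I_N -> {RV P >-> R}).
Variable mu : config N -> R.
Hypotheses (tauP : distributed_as P tau mu) (mu1 : \sum_eta mu eta = 1).

Lemma prod_indicator_imset (I : finType) (B : I -> 'I_N) (C : {set I}) (eta : config N) :
  \prod_(k in C) (eta (B k))%:R = \prod_(i in B @: C) (eta i)%:R :> R.
Proof.
rewrite (partition_big_imset B); apply: eq_bigr => _ /imsetP[k Ck ->].
rewrite (eq_bigr (fun=> (eta (B k))%:R)) => [|l /andP[_ /eqP->]] //.
rewrite prodr_const; case: (eta (B k)); rewrite ?expr1n // expr0n.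
by case: eqP => // /eqP; rewrite (cardD1 k) unfold_in /= Ck eqxx.
Qed.

Lemma joint_cumulant_image r (B : 'I_r -> 'I_N) :
  joint_cumulant P (fun k => tau (B k)) = cumul (image_moments mu B) [set: 'I_r]%SET.
Proof.
rewrite /joint_cumulant ffunE; apply: eq_bigr => pi _; congr (_ * _).
apply: eq_bigr => C _; rewrite ffunE /site_moment.
rewrite (expectation_distributed tauP mu1 (g := fun eta => \prod_(k in C) (eta (B k))%:R)) /=.
- by apply: eq_bigr => eta _; rewrite prod_indicator_imset.
- rewrite [X in measurable_fun _ X](_ : _ = fun w => \prod_(k <- enum C) tau (B k) w).
    by apply: measurable_prod => k _; exact: measurable_funPT.
  by apply/funext => w; rewrite big_enum.
- by move=> eta w tw; apply: eq_bigr => k _; exact: tw.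
Qed.

End CumulantsOfSites.

Theorem proposition9p2 (R : realType) (alpha beta gamma delta : R)
    (halpha : 0 <= alpha) (hbeta : 0 <= beta)
    (hgamma : 0 <= gamma) (hdelta : 0 <= delta)
    (hleft : 0 < alpha + gamma) (hright : 0 < beta + delta) :
  exists C : nat -> R,
    (forall r : nat, 0 < C r) /\
    forall (N : nat), (1 <= N)%N ->
    forall (mu : config N -> R),
      ssep_steady_state alpha beta gamma delta mu ->
    forall (d : measure_display) (T : measurableType d) (P : probability T R)
           (tau : 'I_N -> {RV P >-> R}),
      distributed_as P tau mu ->
      weighted_dependency_graph P (fun _ : {mset 'I_N}%mset => 1) C
        (complete_wgraph R N) tau.
Proof.
have /choice[K HK] : forall r : nat, exists K : R, 0 <= K /\
    forall N (mu : config N -> R), ssep_steady_state alpha beta gamma delta mu ->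
    forall (B : 'I_r -> 'I_N), (0 < r)%N ->
    `|cumul (image_moments mu B) [set: 'I_r]%SET|
      <= K * N%:R^-1 ^+ #|B @: [set: 'I_r]%SET|.-1.
  move=> r; have [K K0 HK] := cumul_image_bound halpha hbeta hgamma hdelta hleft hright r.
  exists K; split=> // N mu st B r0; apply: HK => //.
  by rewrite cardsT card_ord r0 leqnn.
(* Adding 1 makes the constants positive. *)
exists (fun r => K r + 1); split=> [r|N N0 mu st d T P tau tauP [|r] B // _].
  by rewrite ltr_wpDl ?ltr01 //; case: (HK r).
have [K0 HKr] := HK r.+1.
have mu1 : \sum_eta mu eta = 1 by case: st.
rewrite (joint_cumulant_image tauP mu1 (tnth B)) mulr1.
apply: (le_trans (HKr N mu st (tnth B) isT)).
apply: ler_pM; rewrite ?exprn_ge0 ?invr_ge0 ?ler0n ?lerDl ?ler01 //.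
exact: max_tree_weight_ge.
Qed.
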